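(* Fix a prime $p$. For every real number $\alpha>0$ there exists a finitely generated, residually-$p$, torsion group $\Gamma$ such that $RG_p(\Gamma)=\alpha$.
   Context: For a group $A$ let $d(A)$ be the minimal number of generators of $A$, and let $d_p(A)=d\big(A/[A,A]A^p\big)$. For a finitely generated group $G$ and a prime $p$, the $p$-gradient is $RG_p(G)=\inf_H \frac{d_p(H)-1}{[G:H]}$, where the infimum is over all normal subgroups $H\trianglelefteq G$ with $[G:H]=p^k$ for some integer $k\ge 0$. A group is residually-$p$ if the intersection of its normal subgroups of $p$-power index is trivial; it is torsion if every element has finite order. *)

(* Defs.v *)
From Stdlib Require Import Reals List ZArith Znumtheory Arith.
Open Scope R_scope.

Record group := Group {
  gcar : Type;
  gmul : gcar -> gcar -> gcar;
  gone : gcar;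
  ginv : gcar -> gcar;
  gmulA : forall x y z, gmul x (gmul y z) = gmul (gmul x y) z;
  gmul1 : forall x, gmul gone x = x;
  gmulV : forall x, gmul (ginv x) x = gone
}.

Section GroupDefs.
Variable G : group.
Local Notation T := (gcar G).
Local Notation "x * y" := (gmul G x y).
Local Notation "1" := (gone G).
Local Notation "x ^-1" := (ginv G x) (at level 2).

Fixpoint gpow (x : T) (n : nat) : T :=
  match n with O => 1 | S n => x * gpow x n end.

Definition is_subgroup (K : T -> Prop) : Prop :=
  K 1 /\ (forall x y, K x -> K y -> K (x * y)) /\ (forall x, K x -> K (x ^-1)).

Definition gen (S : T -> Prop) (g : T) : Prop :=
  forall K, is_subgroup K -> (forall x, S x -> K x) -> K g.

Definition is_normal (H : T -> Prop) : Prop :=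
  is_subgroup H /\ forall g h, H h -> H (g^-1 * h * g).

Definition has_index (H : T -> Prop) (n : nat) : Prop :=
  exists r : list T, length r = n /\
    forall g, exists! i, (i < n)%nat /\ H ((nth i r 1)^-1 * g).

Definition finitely_generated : Prop :=
  exists l : list T, forall g, gen (fun x => In x l) g.

Definition torsion : Prop := forall g, exists n, (0 < n)%nat /\ gpow g n = 1.

Definition pnormal (p : nat) (H : T -> Prop) : Prop :=
  is_normal H /\ exists k, has_index H (p ^ k).

Definition residually_p (p : nat) : Prop :=
  forall g, (forall H, pnormal p H -> H g) -> g = 1.

Definition frattini_p (p : nat) (H : T -> Prop) : T -> Prop :=
  gen (fun x => (exists a b, H a /\ H b /\ x = a^-1 * b^-1 * a * b)
             \/ (exists a, H a /\ x = gpow a p)).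

Definition gens_mod (p : nat) (H : T -> Prop) (l : list T) : Prop :=
  (forall x, In x l -> H x) /\
  forall h, H h -> gen (fun x => In x l \/ frattini_p p H x) h.

(* d_p(H) = n  (d_p(H) = d(H/[H,H]H^p)) *)
Definition is_dp (p : nat) (H : T -> Prop) (n : nat) : Prop :=
  (exists l, length l = n /\ gens_mod p H l) /\
  forall l, gens_mod p H l -> (n <= length l)%nat.

Definition p_gradient_is (p : nat) (alpha : R) : Prop :=
  let S := fun x : R => exists H k n, is_normal H /\ has_index H (p ^ k) /\
             is_dp p H n /\ x = (INR n - 1) / INR (p ^ k) in
  (forall x, S x -> alpha <= x) /\
  (forall b, (forall x, S x -> b <= x) -> b <= alpha).

End GroupDefs.

(* Main.v *)
From Stdlib Require Import Reals ZArith Znumtheory Lra.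
From HB Require Import structures.
From mathcomp Require Import all_boot all_fingroup all_algebra all_solvable.
From mathcomp Require Import mxrepresentation mxabelem zify boolp.
From mathcomp Require classical_sets.
Require Import Defs.

(* Bounds d_p(H) >= alpha [F : H] + 1, for all normal H of p-power index containing a set
   M of relators, are dual to linear algebra over F_p. They hold in a free group of large
   rank (Schreier), and imposing g^(p^k) = 1 lowers alpha by at most p^-k: H contains
   g^(p^k) either as a p-th power of an element of H, or with at most [F : H] / p^k
   conjugates modulo [H,H]H^p. So one can kill a suitable p^(i+1)-th power of the i-th
   element of F for all i, and then, since the bound passes to unions of chains, take a
   maximal set A of relators for which it still holds with the given alpha. By maximality
   F/A is residually-p. If RG_p(F/A) = b > alpha then, for p^-k <= b - alpha, maximality
   puts every g^(p^k) in A, so F/A has exponent p^k.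
   Positive p-gradient excludes a finite exponent: in a normal subgroup L nearly attaining
   the infimum, pick x of maximal order p^m modulo some normal H <= L. Then (xv)^(p^m) is
   in Phi(H) = [H,H]H^p for all v in H, so that 1 + x + ... + x^(p^m-1) = (x-1)^(p^m-1)
   kills H/Phi(H); this bounds dim H/Phi(H) by p^m - 1 times the number of x-invariant
   functionals, and the latter by Schreier's formula for <x>H in L. The bound obtained is
   smaller by a factor 1 - p^-m than what the choice of L allows. *)

Set Implicit Arguments.
Unset Strict Implicit.
Unset Printing Implicit Defensive.
Local Open Scope nat_scope.
Local Open Scope group_scope.
(* MathComp reserves the delimiter R for ring_scope. *)
Local Delimit Scope R_scope with Re.

(** * Abstract groups as MathComp groups *)

Arguments gpow {G}.
Arguments is_subgroup {G}.
Arguments gen {G}.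
Arguments is_normal {G}.
Arguments has_index {G}.
Arguments pnormal {G}.
Arguments frattini_p {G}.
Arguments gens_mod {G}.

(** Classical equality and choice on the carrier let MathComp's theory of [groupType] apply to
    it. *)
HB.instance Definition _ (G : group) := gen_eqMixin (gcar G).
HB.instance Definition _ (G : group) := gen_choiceMixin (gcar G).

Lemma NatpowE m n : Nat.pow m n = (m ^ n)%N.
Proof. by elim: n => // n IH; rewrite expnS -IH. Qed.

Section RightLaws.
Variable G : group.
Local Notation "x * y" := (gmul G x y).

Lemma gmulVr x : x * ginv G x = gone G.
Proof.
rewrite -[LHS](gmul1 G) -{1}(gmulV G (ginv G x)) -gmulA (gmulA G (ginv G x)).
by rewrite gmulV gmul1 gmulV.
Qed.

Lemma gmul1r x : x * gone G = x.
Proof. by rewrite -(gmulV G x) gmulA gmulVr gmul1. Qed.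

End RightLaws.

HB.instance Definition _ (G : group) :=
  isGroup.Build (gcar G) (gmulA G) (gmul1 G) (gmul1r (G:=G)) (gmulV G) (gmulVr (G:=G)).

(** * Subgroups of abstract groups and their finite quotients *)

Section Subgroups.
Variable G : group.
Local Notation T := (gcar G).
Implicit Types (K H S : T -> Prop) (x y g h : T).

Lemma gpowE x n : gpow x n = x ^+ n.
Proof. by elim: n => // n IH; rewrite expgS -IH. Qed.

Lemma InE x (l : seq T) : List.In x l <-> x \in l.
Proof.
elim: l => //= y l IH; rewrite inE; split.
  by case=> [->|/IH ->]; rewrite ?eqxx ?orbT.
by case/predU1P=> [->|/IH]; [left | right].
Qed.

Lemma is_subgroupI K : K 1 -> (forall x y, K x -> K y -> K (x * y)) ->
  (forall x, K x -> K x^-1) -> is_subgroup K.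
Proof. by []. Qed.

Lemma sg1 K : is_subgroup K -> K 1. Proof. by case. Qed.

Lemma sgM K x y : is_subgroup K -> K x -> K y -> K (x * y).
Proof. by case=> _ [KM _]; apply: KM. Qed.

Lemma sgV K x : is_subgroup K -> K x -> K x^-1.
Proof. by case=> _ [_]; apply. Qed.

Lemma sgVE K x : is_subgroup K -> K x^-1 <-> K x.
Proof. by move=> sK; split=> /(sgV sK) //; rewrite invgK. Qed.

Lemma sgX K x n : is_subgroup K -> K x -> K (x ^+ n).
Proof.
move=> sK Kx; elim: n => [|n IH]; first exact: sg1.
by rewrite expgS; apply: sgM.
Qed.

Lemma nsg H : is_normal H -> is_subgroup H. Proof. by case. Qed.

Lemma nsgJ H h g : is_normal H -> H h -> H (h ^ g).
Proof. by case=> _ nH Hh; rewrite conjgE mulgA; apply: nH. Qed.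

Lemma is_normalI H :
  is_subgroup H -> (forall h g, H h -> H (h ^ g)) -> is_normal H.
Proof. by move=> sH nH; split=> // g h /(nH h g); rewrite conjgE mulgA. Qed.

Lemma gen_sg S : is_subgroup (gen S).
Proof.
split=> [K /sg1 //|]; split=> [x y Sx Sy K sK SK|x Sx K sK SK].
  by apply: sgM => //; [apply: Sx | apply: Sy].
by apply: sgV => //; apply: Sx.
Qed.

Lemma gen_in S x : S x -> gen S x.
Proof. by move=> Sx K _; apply. Qed.

Lemma gen_le S K : is_subgroup K -> (forall x, S x -> K x) -> forall x, gen S x -> K x.
Proof. by move=> sK SK x; apply. Qed.

Lemma gen_mono S K : (forall x, S x -> K x) -> forall x, gen S x -> gen K x.
Proof. by move=> SK; apply: gen_le (gen_sg K) _ => x /SK; apply: gen_in. Qed.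

Lemma gen_normal S : (forall x g, S x -> gen S (x ^ g)) -> is_normal (gen S).
Proof.
move=> nS; apply: is_normalI (gen_sg S) _ => h g Sh.
apply: (Sh (fun h => gen S (h ^ g))) => [|x]; last exact: nS.
split; first by rewrite conj1g; apply: sg1 (gen_sg S).
split=> x; first by move=> y Sx Sy; rewrite conjMg; apply: sgM (gen_sg S) _ _.
by rewrite conjVg; apply: sgV (gen_sg S).
Qed.

Variable p : nat.
Local Notation Phi := (frattini_p p).

Lemma frattini_sg H : is_subgroup (Phi H). Proof. exact: gen_sg. Qed.

Lemma frattini_comm H x y : H x -> H y -> Phi H [~ x, y].
Proof.
by move=> Hx Hy; apply: gen_in; left; exists x, y; rewrite commgEl conjgE !mulgA.
Qed.

Lemma frattini_pow H x : H x -> Phi H (x ^+ p).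
Proof. by move=> Hx; apply: gen_in; right; exists x; rewrite gpowE. Qed.

Lemma frattini_le H K : is_subgroup K -> (forall x y, H x -> H y -> K [~ x, y]) ->
  (forall x, H x -> K (x ^+ p)) -> forall x, Phi H x -> K x.
Proof.
move=> sK KR KX; apply: gen_le sK _ => _ [[x [y [Hx [Hy ->]]]]|[x [Hx ->]]].
  by move: (KR _ _ Hx Hy); rewrite commgEl conjgE !mulgA.
by rewrite gpowE; apply: KX.
Qed.

Lemma frattini_sub H : is_subgroup H -> forall x, Phi H x -> H x.
Proof.
move=> sH; apply: frattini_le => // [x y Hx Hy|x Hx]; last exact: sgX.
by rewrite commgEl conjgE; do !apply: sgM => //; apply: sgV.
Qed.

Lemma frattini_normal H : is_normal H -> is_normal (Phi H).
Proof.
move=> nH; apply: gen_normal => _ g [[x [y [Hx [Hy ->]]]]|[x [Hx ->]]].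
  suff: Phi H ([~ x, y] ^ g) by rewrite commgEl conjgE !mulgA.
  by rewrite conjRg; apply: frattini_comm; apply: nsgJ.
suff: Phi H ((x ^+ p) ^ g) by rewrite gpowE.
by rewrite conjXg; apply: frattini_pow; apply: nsgJ.
Qed.

(** Trades the list of representatives for a map [c] whose fibres are the left cosets, with a
    section [rho]. *)
Lemma has_indexP H n : is_subgroup H ->
  has_index H n <-> exists (c : T -> 'I_n) (rho : 'I_n -> T),
    (forall i, c (rho i) = i) /\ (forall g g', c g = c g' <-> H (g^-1 * g')).
Proof.
move=> sH.
have nthE (r : seq T) i : List.nth i r (gone G) = nth 1 r i.
  by elim: r i => [|x r IH] [|i] /=.
split=> [[r [sr rP]]|[c [rho [cK cP]]]].
  have /choice[c cP] g : exists i : 'I_n, H ((nth 1 r i)^-1 * g).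
    case: (rP g) => i [[ltin Hi] _]; move: ltin => /ltP ltin.
    by exists (Ordinal ltin); rewrite /= -nthE.
  have cU g (i : 'I_n) : H ((nth 1 r i)^-1 * g) -> i = c g.
    case: (rP g) => j [_ jU] Hi; apply: val_inj => /=.
    have jE (k : 'I_n) : H ((nth 1 r k)^-1 * g) -> j = k.
      by move=> Hk; apply: jU; rewrite nthE; split=> //; exact/ltP/ltn_ord.
    by rewrite -(jE i Hi) -(jE _ (cP g)).
  exists c, (fun i => nth 1 r i); split=> [i|g g'].
    by rewrite -(@cU _ i) // mulVg; apply: sg1.
  split=> [e|Hgg'].
    have := cP g'; rewrite -e => Hg'.
    rewrite -(mulKVg (nth 1 r (c g)) g') mulgA; apply: sgM => //.
    by rewrite -[g^-1 * _]invgK invMg invgK; apply: sgV.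
  by apply: cU; rewrite -(mulKVg g g') mulgA; apply: sgM.
exists [seq rho i | i <- enum 'I_n]; split.
  by rewrite -[length _]/(size _) size_map size_enum_ord.
have Eth (i : 'I_n) : List.nth i [seq rho i | i <- enum 'I_n] (gone G) = rho i.
  by rewrite nthE (nth_map i) ?size_enum_ord // nth_ord_enum.
move=> g; exists (c g); split=> [|j [/ltP ltjn]].
  by split; [exact/ltP/ltn_ord | rewrite Eth; apply/cP; rewrite cK].
by rewrite (Eth (Ordinal ltjn)) => /cP; rewrite cK => <-.
Qed.

(** By normality the product of cosets is computed on representatives, so ['I_n] itself can carry
    the quotient group. *)
Lemma finite_quotient H n : is_normal H -> has_index H n ->
  exists (Q : finGroupType) (q : T -> Q), [/\ {morph q : x y / x * y},
    forall z, exists x, q x = z, forall x, q x = 1 <-> H x & #|Q| = n].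
Proof.
move=> nH /(has_indexP _ (nsg nH))[c [rho [cK cP]]].
have sH := nsg nH.
pose mul i j := c (rho i * rho j); pose inv i := c (rho i)^-1.
have cM x y : c (x * y) = mul (c x) (c y).
  apply/cP; rewrite invMg -mulgA (mulgA x^-1) -(mulKVg (rho (c y)) (x^-1 * _ * _)).
  rewrite mulgA; apply: sgM => //; first by apply/cP; rewrite cK.
  by rewrite -conjgE; apply: nsgJ => //; apply/cP; rewrite cK.
have mA : associative mul.
  by move=> i j k; rewrite -[i]cK -[j]cK -[k]cK -!cM mulgA.
have m1 : left_id (c 1) mul by move=> i; rewrite -[i]cK -cM mul1g.
have mV : left_inverse (c 1) inv mul.
  by move=> i; rewrite -{2}[i]cK /inv -cM mulVg.
pose Q : finGroupType := HB.pack 'I_n (Finite_isGroup.Build 'I_n mA m1 mV).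
exists Q, c; split=> [||x|]; [exact: cM|by move=> i; exists (rho i)| |exact: card_ord].
by split=> [/cP|Hx]; [|apply/cP]; rewrite mulg1 sgVE.
Qed.

Lemma has_index_classifier (I : finType) (f : T -> I) S : is_subgroup S ->
  (forall g g', f g = f g' <-> S (g^-1 * g')) ->
  has_index S #|[set i | `[< exists g, f g = i >]]|.
Proof.
move=> sS fP; set A := [set i | _].
have Af g : f g \in A by rewrite inE; apply/asboolP; exists g.
have /choice[rho rhoP] (i : 'I_#|A|) : exists g, f g = enum_val i.
  by have := enum_valP i; rewrite inE => /asboolP.
apply/has_indexP => //; exists (fun g => enum_rank_in (Af 1) (f g)), rho.
have rkE g i : (enum_rank_in (Af 1) (f g) = i) <-> (f g = enum_val i).
  split=> [<-|->]; first by rewrite enum_rankK_in.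
  by rewrite enum_valK_in.
split=> [i|g g']; first by apply/rkE.
by rewrite -fP rkE enum_rankK_in.
Qed.

(** An element is classified by the first position in [l] that represents its coset. *)
Lemma cover_index S (l : seq T) : is_subgroup S ->
  (forall g, exists2 x, x \in l & S (x^-1 * g)) -> exists n, has_index S n.
Proof.
move=> sS lP; pose P g x := `[< S (x^-1 * g) >].
have hasP g : has (P g) l.
  by have [x lx Sx] := lP g; apply/hasP; exists x => //; apply/asboolP.
have fltP g : find (P g) l < size l by rewrite -has_find.
eexists; apply: (@has_index_classifier _ (fun g => Ordinal (fltP g))) => // g g'.
have fS h : S ((nth 1 l (find (P h) l))^-1 * h) by apply/asboolP/(nth_find 1 (hasP h)).
split=> [[e]|Sgg'].
  have := fS g'; rewrite -e => Hg'.
  rewrite -(mulKVg (nth 1 l (find (P g) l)) g') mulgA; apply: sgM => //.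
  by rewrite -[g^-1 * _]invgK invMg invgK; apply: sgV => //; apply: fS.
apply: val_inj => /=; apply: eq_find => x; apply/asboolP/asboolP => Sx.
  by rewrite -(mulKVg g g') mulgA; apply: sgM.
have -> : x^-1 * g = x^-1 * g' * (g^-1 * g')^-1 by rewrite invMg invgK mulgA mulgK.
by apply: sgM => //; apply: sgV.
Qed.

(** Schreier's generators: for [x] in [s] and a coset representative [r], take
    [(t (x * r))^-1 * x * r]. *)
Lemma fg_index H n : finitely_generated G -> is_subgroup H -> has_index H n ->
  exists l : seq T, (forall x, x \in l -> H x) /\
    (forall h, H h -> gen (fun x => x \in l) h).
Proof.
case=> s sP sH /(has_indexP _ sH)[c [rho [cK cP]]].
pose t g := rho (c g).
have tP g : H ((t g)^-1 * g) by apply/cP; rewrite /t cK.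
have tE g g' : H (g^-1 * g') -> t g = t g' by move/cP; rewrite /t => ->.
have tt g : t (t g) = t g by rewrite /t cK.
pose l0 := [seq (t (x * rho i))^-1 * x * rho i | x <- s, i <- enum 'I_n].
(* The representative of the coset [H] may differ from 1, so it joins the Schreier generators. *)
pose l := t 1 :: l0; exists l.
have Ht1 : H (t 1) by have := tP 1; rewrite mulg1 sgVE.
split=> [x|].
  rewrite inE => /predU1P[-> //|/allpairsP[[y i] [_ _ ->]]] /=.
  by rewrite -mulgA; apply: tP.
have sl := gen_sg (fun x => x \in l).
(* Quantifying over all representatives makes [X] stable under products and inverses, so it need
   only be checked on [s]. *)
pose X g := forall r, t r = r -> gen (fun x => x \in l) ((t (g * r))^-1 * g * r).
have Xg g : X g.
  apply: (sP g X) => [|x]; last first.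
    move=> /InE sx r rE; apply: gen_in; rewrite inE; apply/orP; right.
    by apply/allpairsP; exists (x, c r); rewrite sx mem_enum /= -/(t r) rE.
  split; first by move=> r rE; rewrite mulg1 mul1g rE mulVg; apply: sg1.
  split=> [x y Xx Xy r rE|x Xx r rE].
    have := sgM sl (Xx _ (tt (y * r))) (Xy _ rE).
    rewrite !mulgA mulgK (tE (x * t (y * r)) (x * y * r)) //.
    by rewrite invMg -mulgA -!(mulgA x) mulKg.
  have := sgV sl (Xx _ (tt (x^-1 * r))).
  rewrite (tE _ r) ?rE; first by rewrite -!mulgA !invMg invgK !mulgA.
  by rewrite invMg -mulgA; apply: tP.
move=> h Hh; have := Xg h _ (tt 1).
rewrite (tE _ 1) ?mulg1; last first.
  by rewrite sgVE //; apply: sgM.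
move=> Gl; have Gt : gen (fun x => x \in l) (t 1) by apply: gen_in; rewrite inE eqxx.
rewrite -[h](mulKVg (t 1)); apply: (sgM sl) => //.
rewrite -[_^-1 * h](mulgK (t 1)); apply: (sgM sl) => //; exact: (sgV sl).
Qed.

End Subgroups.

Section Morphisms.
Variables (G Q : groupType) (q : G -> Q).
Hypothesis qM : {morph q : x y / x * y}.

Lemma quo1 : q 1 = 1.
Proof. by apply: (mulgI (q 1)); rewrite -qM !mulg1. Qed.

Lemma quoV : {morph q : x / x^-1}.
Proof. by move=> x; apply: (mulgI (q x)); rewrite -qM !mulgV quo1. Qed.

Lemma quoX n : {morph q : x / x ^+ n}.
Proof. by move=> x; elim: n => [|n IH]; rewrite ?quo1 // !expgS qM IH. Qed.

Lemma quoJ : {morph q : x y / x ^ y}.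
Proof. by move=> x y; rewrite !conjgE !qM quoV. Qed.

Lemma quoR : {morph q : x y / [~ x, y]}.
Proof. by move=> x y; rewrite !commgEl qM quoV quoJ. Qed.

Lemma quo_eq x y : q x = q y <-> q (x^-1 * y) = 1.
Proof.
rewrite qM quoV; split=> [->|e]; first exact: mulVg.
by rewrite -[LHS]mulg1 -e mulKVg.
Qed.

End Morphisms.

Section Quotients.
Variables (G : group) (Q : finGroupType) (q : gcar G -> Q).
Hypothesis qM : {morph q : x y / x * y}.
Hypothesis q_surj : forall z, exists x, q x = z.

Lemma preim_sg (B : {group Q}) : is_subgroup (fun x => q x \in B).
Proof.
apply: is_subgroupI => [|x y Bx By|x Bx].
- by rewrite quo1 // group1.
- by rewrite qM groupM.
- by rewrite quoV // groupV.
Qed.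

Lemma preim_index (B : {group Q}) : has_index (fun x => q x \in B) #|[set: Q] : B|.
Proof.
have := @has_index_classifier G _ (fun g => q g *: B) _ (preim_sg B).
set A := [set i | _] => indA; suff -> : #|[set: Q] : B| = #|A|.
  apply: indA => g g'; rewrite qM quoV // -mem_lcoset; split=> [->|].
    exact: lcoset_refl.
  by move/lcoset_eqP.
rewrite -card_lcosets; apply: eq_card => C; rewrite inE.
apply/lcosetsP/asboolP => [[z _ ->]|[g <-]]; last by exists (q g); rewrite ?inE.
by have [g <-] := q_surj z; exists g.
Qed.

Lemma preim_pnormal p (B : {group Q}) : prime p -> p.-group [set: Q] ->
  (forall b z, b \in B -> b ^ z \in B) -> pnormal p (fun x => q x \in B).
Proof.
move=> p_pr pQ nB; split.
  by apply: is_normalI (preim_sg B) _ => h g Bh; rewrite quoJ //; apply: nB.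
have /p_natP[k ek] : p.-nat #|[set: Q] : B|.
  exact: pnat_dvd (dvdn_indexg _ _) pQ.
by exists k; rewrite NatpowE -ek; apply: preim_index.
Qed.

Lemma gen_quo (S : gcar G -> Prop) (B : {group Q}) :
  (forall x, S x -> q x \in B) -> forall x, gen S x -> q x \in B.
Proof. by move=> SB; apply: gen_le => //; apply: preim_sg. Qed.

Lemma gen_lift (S : gcar G -> Prop) (B : {set Q}) :
  (forall z, z \in B -> exists x, S x /\ q x = z) ->
  forall z, z \in <<B>> -> exists x, gen S x /\ q x = z.
Proof.
move=> BS z; pose C := [set z | `[< exists x, gen S x /\ q x = z >]].
have sS := gen_sg S.
have gC : group_set C.
  apply/group_setP; split=> [|y1 y2]; rewrite !inE.
    by apply/asboolP; exists 1; split; [exact: (sg1 sS) | exact: quo1].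
  move=> /asboolP[x1 [S1 <-]] /asboolP[x2 [S2 <-]]; apply/asboolP.
  by exists (x1 * x2); split; [apply: (sgM sS) | rewrite qM].
have /subsetP sBC : <<B>> \subset fingroup.Group gC.
  rewrite gen_subG; apply/subsetP => y /BS[x [Sx <-]].
  by rewrite inE; apply/asboolP; exists x; split=> //; apply: gen_in.
by move/sBC; rewrite inE => /asboolP.
Qed.

End Quotients.

Section PQuotients.
Variables (G : group) (p : nat).
Hypothesis p_pr : prime p.
Local Notation T := (gcar G).
Implicit Types H K : T -> Prop.

Lemma image_group (Q : finGroupType) (q : T -> Q) K : {morph q : x y / x * y} ->
  is_subgroup K -> (forall x, q x = 1 -> K x) ->
  exists B : {group Q}, forall x, q x \in B <-> K x.
Proof.
move=> qM sK kK; pose B := [set z | `[< exists x, K x /\ q x = z >]].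
have gB : group_set B.
  apply/group_setP; split=> [|y1 y2]; rewrite !inE.
    by apply/asboolP; exists 1; split; [exact: sg1 | exact: quo1].
  move=> /asboolP[x1 [K1 <-]] /asboolP[x2 [K2 <-]]; apply/asboolP.
  by exists (x1 * x2); split; [apply: sgM | rewrite qM].
exists (fingroup.Group gB) => x; rewrite inE; split=> [/asboolP[y [Ky qyx]]|Kx].
  rewrite -(mulKVg y x); apply: sgM => //; apply: kK.
  by rewrite qM quoV // qyx mulVg.
by apply/asboolP; exists x.
Qed.

Lemma pquotient H k : is_normal H -> has_index H (p ^ k)%N ->
  exists (Q : finGroupType) (q : T -> Q), [/\ {morph q : x y / x * y},
    forall z, exists x, q x = z, forall x, q x = 1 <-> H x,
    #|Q| = (p ^ k)%N & p.-group [set: Q]].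
Proof.
move=> nH /(finite_quotient nH)[Q [q [qM qS qK cQ]]].
by exists Q, q; split=> //; rewrite /pgroup cardsT cQ pnatX pnat_id.
Qed.

(** The image of [K] in the finite p-group G/H has p-power index, and this is the index of [K]. *)
Lemma sub_pnormal H K : pnormal p H -> is_normal K -> (forall x, H x -> K x) ->
  pnormal p K.
Proof.
case=> nH [k]; rewrite NatpowE => /(pquotient nH)[Q [q [qM qS qK _ pQ]]] nK sHK.
have [|B BP] := @image_group Q q K qM (nsg nK); first by move=> x /qK /sHK.
have [_ [j]] : pnormal p (fun x => q x \in B).
  apply: preim_pnormal => // b z; have [x <-] := qS b; have [y <-] := qS z.
  by rewrite -quoJ // !BP; apply: nsgJ.
rewrite (_ : (fun x => _) = K) => [indK|]; first by split=> //; exists j.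
by apply/funext => x; apply/propext.
Qed.

Lemma expg_index H k x : is_normal H -> has_index H (p ^ k)%N -> H (x ^+ (p ^ k)).
Proof.
move=> nH /(pquotient nH)[Q [q [qM qS qK cQ _]]].
by apply/qK; rewrite quoX // -cQ -cardsT expg_cardG ?inE.
Qed.

End PQuotients.

(** * Quotients of abstract groups *)

(** Elements are the classes, as predicates [E w]; extensionality turns [E u v] into equality.
    Quotient groups and free groups are both built this way. *)
Lemma setoid_group (W : Type) (mul : W -> W -> W) (one : W) (inv : W -> W)
    (E : W -> W -> Prop) :
  (forall u, E u u) -> (forall u v, E u v -> E v u) ->
  (forall u v w, E u v -> E v w -> E u w) ->
  (forall u u' v v', E u u' -> E v v' -> E (mul u v) (mul u' v')) ->
  (forall u v w, E (mul u (mul v w)) (mul (mul u v) w)) ->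
  (forall u, E (mul one u) u) -> (forall u, E (mul (inv u) u) one) ->
  exists (Q : group) (f : W -> gcar Q), [/\ {morph f : u v / mul u v >-> u * v},
    forall z, exists u, f u = z & forall u v, f u = f v <-> E u v].
Proof.
move=> Er Es Et Em EA E1 EV.
pose C := {S : W -> Prop | exists w, S = E w}.
pose f w : C := exist _ (E w) (ex_intro _ w erefl).
have fP u v : f u = f v <-> E u v.
  split=> [[Euv]|Euv]; first by rewrite Euv.
  by apply/eq_exist/funext => w; apply/propext; split; apply: Et => //; apply: Es.
have fS z : exists u, f u = z by case: z => S [w Sw]; exists w; apply/eq_exist.
have /choice[r rK] := fS.
pose m x y := f (mul (r x) (r y)).
have fM u v : f (mul u v) = m (f u) (f v).
  by apply/fP; apply: Em; apply/fP; rewrite rK.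
have mA x y z : m x (m y z) = m (m x y) z.
  by rewrite -[x]rK -[y]rK -[z]rK -!fM; apply/fP.
have m1 x : m (f one) x = x by rewrite -[x]rK -fM; apply/fP.
have mV x : m (f (inv (r x))) x = f one by rewrite -{2}[x]rK -fM; apply/fP.
by exists (@Defs.Group C m (f one) (fun x => f (inv (r x))) mA m1 mV), f; split.
Qed.

Lemma quotient_group (G : group) (N : gcar G -> Prop) : is_normal N ->
  exists (Q : group) (f : gcar G -> gcar Q), [/\ {morph f : x y / x * y},
    forall z, exists x, f x = z & forall x, f x = 1 <-> N x].
Proof.
move=> nN; have sN := nsg nN.
have [||||||u|Q [f [fM fS fP]]] := @setoid_group _ (gmul G) (gone G) (ginv G)
    (fun x y => N (x^-1 * y)).
- by move=> u; rewrite mulVg; apply: sg1.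
- by move=> u v Nuv; rewrite -[_ * _]invgK invMg invgK; apply: sgV.
- move=> u v w Nuv Nvw; rewrite -(mulKVg v w) mulgA; exact: sgM.
- move=> u u' v v' Nu Nv; have -> : (u * v)^-1 * (u' * v') = (u^-1 * u') ^ v * (v^-1 * v').
    by rewrite conjgE invMg !mulgA mulgK.
  by apply: sgM => //; apply: nsgJ.
- by move=> u v w; rewrite gmulA mulVg; apply: sg1.
- by move=> u; rewrite gmul1 mulVg; apply: sg1.
- by rewrite gmulV mulVg; apply: sg1.
exists Q, f; split=> // x.
have -> : 1 = f 1 by apply: (mulgI (f 1)); rewrite mulg1 -fM gmul1.
by rewrite fP mulg1; split=> /(sgVE _ sN).
Qed.

Lemma commute_gen (G : group) (S : gcar G -> Prop) x :
  (forall y, S y -> commute x y) -> forall y, gen S y -> commute x y.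
Proof.
move=> Sx; apply: gen_le => //; apply: is_subgroupI; first exact: commute1.
  by move=> y z; apply: commuteM.
by move=> y; apply: commuteV.
Qed.

(** Induction on [l]: the head [x] commutes with everything, so each element is [x ^+ a * y] with
    [a < p] and [y] generated by the tail. *)
Lemma gen_abelian_exponent (G : group) p (l : seq (gcar G)) : (0 < p)%N ->
  {in l &, forall x y, commute x y} -> (forall x, x \in l -> x ^+ p = 1) ->
  exists E : seq (gcar G), forall g, gen (fun x => x \in l) g -> g \in E.
Proof.
move=> p_gt0; elim: l => [|x l IH] cl xl.
  exists [:: 1]; apply: gen_le => //; apply: is_subgroupI => [|y z|y]; rewrite !inE //.
    by move=> /eqP-> /eqP->; rewrite mulg1.
  by move=> /eqP->; rewrite invg1.
have [E EP] : exists E : seq (gcar G), forall g, gen (fun x => x \in l) g -> g \in E.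
  apply: IH => [y z ly lz|y ly]; first by apply: cl; rewrite inE ?ly ?lz orbT.
  by apply: xl; rewrite inE ly orbT.
have xp : x ^+ p = 1 by apply: xl; rewrite inE eqxx.
have sl := gen_sg (fun y => y \in l).
have xc y : gen (fun y => y \in l) y -> commute x y.
  by apply: commute_gen => z lz; apply: cl; rewrite inE ?eqxx ?lz ?orbT.
exists [seq x ^+ a * y | a <- iota 0 p, y <- E] => g Gg.
have [a [y [Gy ->]]] : exists a y, gen (fun y => y \in l) y /\ g = x ^+ a * y.
  apply: (Gg (fun g => exists a y, gen (fun y => y \in l) y /\ g = x ^+ a * y)) => [|z].
    apply: is_subgroupI => [|_ _ [a [y [Gy ->]]] [b [z [Gz ->]]]|_ [a [y [Gy ->]]]].
    - by exists 0%N, 1; split; [exact: sg1 | rewrite mulg1].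
    - exists (a + b)%N, (y * z); split; first exact: (sgM sl).
      rewrite expgnDr -!mulgA; congr (_ * _); rewrite !mulgA; congr (_ * _).
      exact: (commuteX b (commute_sym (xc _ Gy))).
    - exists (a * p.-1)%N, y^-1; split; first exact: (sgV sl).
    rewrite invMg.
    have -> : x ^- a = x ^+ (a * p.-1).
      by apply: (mulgI (x ^+ a)); rewrite mulgV -expgnDr -mulnS prednK // mulnC expgnA xp expg1n.
    exact: (commuteX _ (commute_sym (commuteV (xc _ Gy)))).
  rewrite inE => /predU1P[->|lz].
    by exists 1%N, 1; split; [exact: sg1 | rewrite mulg1].
  by exists 0%N, z; split; [exact: gen_in | rewrite mul1g].
apply/allpairsP; exists (a %% p, y); split; [|exact: EP|].
  by rewrite mem_iota ltn_pmod.
by rewrite {1}(divn_eq a p) expgnDr mulnC expgnA xp expg1n mul1g.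
Qed.

Section Frattini.
Variables (G : group) (p : nat).
Hypothesis p_pr : prime p.
Hypothesis fgG : finitely_generated G.
Local Notation T := (gcar G).
Implicit Types H K : T -> Prop.
Local Notation Phi := (frattini_p p).

(** [H] is finitely generated, so H/Phi(H) is finitely generated abelian of exponent p, hence
    finite; its elements and the cosets of [H] together cover G/Phi(H). *)
Lemma frattini_finite_index H k : is_normal H -> has_index H (p ^ k)%N ->
  exists n, has_index (Phi H) n.
Proof.
move=> nH indH; have sH := nsg nH.
have [l [lH Hl]] := fg_index fgG sH indH.
have [Q [f [fM fS fK]]] := quotient_group (frattini_normal p nH).
have fE x y : f x = f y <-> Phi H (x^-1 * y). by rewrite -fK; apply: quo_eq.
have [|||E EP] := @gen_abelian_exponent Q p (map f l).
- exact: prime_gt0.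
- move=> _ _ /mapP[x lx ->] /mapP[y ly ->]; rewrite /commute -!fM; apply/fE.
  have -> : (x * y)^-1 * (y * x) = [~ y, x] by rewrite invMg -mulgA.
  by apply: frattini_comm; apply: lH.
- by move=> _ /mapP[x lx ->]; rewrite -(quoX fM); apply/fK; apply: frattini_pow; apply: lH.
have /choice[r rK] := fS.
have [c [rho [cK cP]]] := (has_indexP _ sH).1 indH.
apply: (@cover_index _ _ [seq rho i * r z | i <- enum 'I_(p ^ k), z <- E]).
  exact: frattini_sg.
move=> g; have Hg : H ((rho (c g))^-1 * g) by apply/cP; rewrite cK.
exists (rho (c g) * r (f ((rho (c g))^-1 * g))); last first.
  by rewrite invMg -mulgA; apply/fE; rewrite rK.
apply/allpairsP; exists (c g, f ((rho (c g))^-1 * g)); split=> //=.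
  by rewrite mem_enum.
apply: EP; apply: (Hl _ Hg (fun x => gen (fun z => z \in map f l) (f x))) => [|x lx].
  have sl := gen_sg (fun z => z \in map f l).
  apply: is_subgroupI => [|x y fx fy|x fx]; first by rewrite quo1 //; exact: sg1.
    by rewrite fM; apply: (sgM sl).
  by rewrite quoV //; apply: (sgV sl).
by apply: gen_in; apply: map_f.
Qed.

(** Every element of the finite group G/Phi(H) has order dividing p^(k+1), so Cauchy's theorem
    leaves p as the only prime divisor of its order. *)
Lemma frattini_pnormal H : pnormal p H -> pnormal p (Phi H).
Proof.
case=> nH [k]; rewrite NatpowE => indH.
have nPhi := frattini_normal p nH.
have [n /(finite_quotient nPhi)[Q [q [qM qS qK cQ]]]] := frattini_finite_index nH indH.
have pQ : p.-group [set: Q].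
  rewrite /pgroup; apply/pnatP => [|r r_pr]; first by rewrite cardG_gt0.
  case/Cauchy=> // z _ oz; have [x qx] := qS z.
  have : z ^+ (p ^ k.+1) = 1.
    rewrite -qx -(quoX qM) expnSr expgnA; apply/qK; apply: frattini_pow.
    exact: expg_index.
  move/eqP; rewrite -order_dvdn oz => r_dvd.
  have := dvdn_trans (dvdnn r) r_dvd; rewrite Euclid_dvdX // => /andP[].
  by rewrite dvdn_prime2 // inE.
have := preim_pnormal (q := q) (B := 1%G) qM qS p_pr pQ.
rewrite (_ : (fun x => _) = Phi H); last first.
  by apply/funext => x; apply/propext; rewrite -qK; split=> [/set1gP|->]; rewrite ?group1.
by apply=> b z /set1gP->; rewrite conj1g group1.
Qed.

End Frattini.

Import GRing.Theory.

(** * Generator ranks in finite p-groups *)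

Section SchreierBound.
Variables (Q : finGroupType) (F : fieldType) (B : vectType F).
Variables (l : seq Q) (K : {group Q}) (kap : Q -> B).
Local Notation L := <<[set x in l]>>.
Hypothesis sKL : K \subset L.
Hypothesis kapM : {in K &, forall x y, kap (x * y) = (kap x + kap y)%R}.
Hypothesis kap_span : (<<[seq kap x | x in K]>> = fullv)%VS.

Let Om := lcosets K L.
Let n := #|Om :\ gval K|.
Let e (v : {set Q}) : 'rV[F]_n := (\row_j (enum_val j == v)%:R)%R.
(* A cocycle on the Schreier coset graph of K in L, equal to (kap g, 0) at the base vertex
   for g in K. It is determined by its values on the #|L : K| * size l edges, and these
   values span B x F^n. *)
Let D g v : (B * 'rV[F]_n)%type :=
  (kap ((repr (g *: v))^-1 * g * repr v), (e (g *: v)%g - e v)%R).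

Let cosetE v : v \in Om -> v = repr v *: K.
Proof.
case/lcosetsP=> z _ ->; apply/esym/lcoset_eqP.
by apply: mem_repr (lcoset_refl K z).
Qed.

Let actOm g v : g \in L -> v \in Om -> g *: v \in Om.
Proof.
move=> Lg /lcosetsP[z Lz ->]; rewrite -lcosetM.
by apply/lcosetsP; exists (g * z); rewrite ?groupM.
Qed.

Let kinK g v : g \in L -> v \in Om -> (repr (g *: v))^-1 * g * repr v \in K.
Proof.
move=> Lg Ov; rewrite -mulgA -mem_lcoset -cosetE ?actOm //.
by rewrite mem_lcoset mulKg {2}(cosetE Ov) lcoset_refl.
Qed.

Let DM g h v : g \in L -> h \in L -> v \in Om -> D (g * h) v = (D g (h *: v) + D h v)%R.
Proof.
move=> Lg Lh Ov; rewrite /D lcosetM; congr (_, _).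
  rewrite /= -kapM ?kinK ?actOm //; congr (kap _).
  by rewrite !mulgA mulgK.
by rewrite /= addrA subrK.
Qed.

Let S := (<<[seq D s v | s <- l, v <- enum Om]>>)%VS.

Let DS g v : g \in L -> v \in Om -> D g v \in S.
Proof.
move=> Lg; move: v; pose X := [set g in L | [forall v in Om, D g v \in S]].
suff /subsetP/(_ _ Lg): L \subset X by rewrite inE => /andP[_ /forall_inP].
have gX : group_set X.
  apply/group_setP; split=> [|g1 g2].
    rewrite inE group1; apply/forall_inP => v Ov.
    have /eqP := DM (group1 _) (group1 _) Ov.
    by rewrite mulg1 lcoset1 -[X in X == _]addr0 (inj_eq (addrI _)) => /eqP<-; apply: mem0v.
  rewrite !inE => /andP[L1 /forall_inP S1] /andP[L2 /forall_inP S2].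
  rewrite groupM //; apply/forall_inP => v Ov.
  by rewrite DM // rpredD ?S1 ?S2 ?actOm.
rewrite -[X]/(gval (fingroup.Group gX)) gen_subG; apply/subsetP => s; rewrite inE => ls.
rewrite inE mem_gen ?inE //; apply/forall_inP => v Ov; apply: memv_span.
by apply/allpairsP; exists (s, v); rewrite mem_enum.
Qed.

Let K_Om : gval K \in Om.
Proof. by apply/lcosetsP; exists 1; rewrite ?group1 ?lcoset1. Qed.

Let eK : e K = 0%R.
Proof.
apply/rowP => j; rewrite !mxE; have := enum_valP j; rewrite !inE.
by case/andP => /negPf ->.
Qed.

Let kap1 : kap 1 = 0%R.
Proof. by apply: (addrI (kap 1)); rewrite -kapM ?group1 // mulg1 addr0. Qed.

(** Schreier's bound d(K) <= |L : K| (|l| - 1) + 1 for the elementary abelian image [B] of [K],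
    stated without subtraction. *)
Lemma schreier_bound : (\dim {:B} + #|L : K| <= #|L : K| * size l + 1)%N.
Proof.
have SB b : (b, 0%R) \in S.
  pose i (b : B) : (B * 'rV[F]_n)%type := (b, 0%R).
  have iL : linear i.
    by move=> a u v; congr (_, _); rewrite /= scaler0 addr0.
  pose il := linfun (HB.pack i (GRing.isLinear.Build F B (B * 'rV[F]_n)%type _ i iL)
                     : {linear B -> (B * 'rV[F]_n)%type}).
  have : b \in (il @^-1: S)%VS.
    have /subvP : (fullv <= il @^-1: S)%VS; last by apply; apply: memvf.
    rewrite -kap_span; apply/span_subvP => _ /imageP[x Kx ->].
    rewrite -memv_preim lfunE /= /i.
    have := DS (subsetP sKL _ Kx) K_Om.
    by rewrite /D lcoset_id // repr_group invg1 mul1g mulg1 subrr.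
  by rewrite -memv_preim lfunE.
(* Moving from the base vertex to [v] by [repr v] has first component [kap 1 = 0], so it yields the
   basis vector [(0, e v)]. *)
have SR r : (0%R, r) \in S.
  have -> : ((0, r) = \sum_j r 0%R j *: (0, delta_mx 0 j) :> (B * 'rV[F]_n)%type)%R.
    rewrite {1}(row_sum_delta r).
    elim/big_rec2: _ => //= j _ u _ <-.
    by congr (_, _); rewrite /= ?scaler0 ?addr0.
  apply: rpred_sum => j _; apply: rpredZ.
  have := enum_valP j; rewrite !inE => /andP[vK Ov].
  have Lr : repr (enum_val j) \in L.
    case/lcosetsP: (Ov) => z Lz ->.
    have: repr (z *: K) \in z *: K by apply: mem_repr (lcoset_refl K z).
    by case/lcosetP => k Kk ->; rewrite groupM // (subsetP sKL).
  have := DS Lr K_Om; rewrite /D -cosetE // repr_group mulg1 mulVg kap1 eK subr0.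
  suff -> : e (enum_val j) = delta_mx 0%R j by [].
  by apply/rowP => k; rewrite !mxE eqxx /= (inj_eq enum_val_inj) eq_sym.
have : (\dim S <= #|L : K| * size l)%N.
  by apply: leq_trans (dim_span _) _; rewrite size_allpairs mulnC -cardE card_lcosets.
have -> : S = fullv.
  apply/vspaceP => -[b r]; rewrite memvf.
  suff -> : (b, r) = ((b, 0) + (0, r))%R by rewrite rpredD.
  by congr (_, _); rewrite /= ?addr0 ?add0r.
have -> : #|L : K| = n.+1 by rewrite -card_lcosets (cardsD1 (gval K)) K_Om.
rewrite !dimvf.
have dimE : dim (B * 'rV[F]_n)%type = (dim B + 1 * n)%N by [].
by rewrite dimE; lia.
Qed.

End SchreierBound.

(** After multiplication by X - 1 both sides become X^(p^m) - 1, the left one by Frobenius. *)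
Lemma geometric_sum_pchar (R : idomainType) p m : p \in [pchar R]%R ->
  (('X - 1) ^+ (p ^ m).-1 = \sum_(i < p ^ m) 'X^i :> {poly R})%R.
Proof.
move=> pR; have p_pr := pcharf_prime pR.
have pP : p \in [pchar {poly R}]%R by rewrite pchar_poly.
have nz : ('X - 1 : {poly R})%R != 0%R by rewrite -[1%R]/(1%:P)%R polyXsubC_eq0.
apply: (mulfI nz); rewrite -exprS prednK ?expn_gt0 ?prime_gt0 // -subrX1.
elim: m => [|m IH]; first by rewrite !expr1.
by rewrite expnSr !exprM IH -!(pFrobenius_autE pP) rmorphB rmorph1.
Qed.

(** Each further factor [A] lowers the rank by at most the dimension of the kernel of [A]. For
    nilpotent [A] this bounds the whole dimension. *)
Lemma corank_exp (F : fieldType) n (A : 'M[F]_n.+1) k :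
  (n.+1 <= \rank (A ^+ k)%R + k * (n.+1 - \rank A))%N.
Proof.
elim: k => [|k IH]; first by rewrite expr0 mxrank1 addn0.
have := mxrank_mul_ker (A ^+ k)%R A.
have := mxrankS (capmxSr (A ^+ k)%R (kermx A)); rewrite mxrank_ker.
rewrite exprSr -[(_ * A)%R]/(_ *m A)%R; lia.
Qed.

Section SplitHom.
Variables (p : nat) (Q : finGroupType) (V : {group Q}) (x : Q) (m : nat).
Hypotheses (p_pr : prime p) (abelV : p.-abelem V) (ntV : V :!=: 1).
Hypotheses (nVx : x \in 'N(V)) (m_gt0 : (0 < m)%N) (tiVx : V :&: <[x]> = 1).
Hypothesis xvX : forall v, v \in V -> (x * v) ^+ (p ^ m) = 1.
Hypothesis ox : #[x] = (p ^ m)%N.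
Local Notation X := <[x]>.
Local Notation E := (abelem_rV abelV ntV).

Let nVX : X \subset 'N(V). Proof. by rewrite cycle_subG. Qed.

Let A := abelem_repr abelV ntV nVX x.
Let N := (A - 1)%R.
Let C := col_base (cokermx N).
Let b := \rank (cokermx N).

Let EJ v : v \in V -> E (v ^ x) = (E v *m A)%R.
Proof. by move=> Vv; apply: abelem_rV_J (cycle_id x). Qed.

(** Here w = v^(x^(n-1)) ... v^x v, whose coordinates are a geometric sum in [A]. *)
Let xv_expg v n : v \in V ->
  exists w, [/\ w \in V, (x * v) ^+ n = x ^+ n * w & E w = (E v *m \sum_(i < n) A ^+ i)%R].
Proof.
move=> Vv; elim: n => [|n [w [Vw wE EwE]]].
  by exists 1; rewrite group1 mulg1 abelem_rV_1 big_ord0 mulmx0.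
exists (w ^ x * v); split.
- by rewrite groupM // memJ_norm.
- by rewrite !expgSr wE conjgE !mulgA mulgK.
rewrite abelem_rV_M ?memJ_norm // EJ // EwE big_ord_recl /= expr0 mulmxDr mulmx1 addrC.
congr (_ + _)%R; rewrite -mulmxA; congr (_ *m _)%R; rewrite mulmx_suml.
by apply: eq_bigr => i _; rewrite exprSr.
Qed.

Let norm0 : (\sum_(i < p ^ m) A ^+ i = 0)%R.
Proof.
apply/row_matrixP => i; rewrite row0 rowE.
have [v Vv <-] : exists2 v, v \in V & E v = delta_mx 0%R i.
  by exists (rVabelem abelV ntV (delta_mx 0%R i)); rewrite ?mem_rVabelem ?rVabelemK.
have [w [Vw wE <-]] := xv_expg (p ^ m) Vv.
have := xvX Vv; rewrite wE -[X in _ = X](xvX (group1 V)) mulg1 -{2}[_ ^+ _]mulg1.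
by move/mulgI->; rewrite abelem_rV_1.
Qed.

(** The norm 1 + A + ... + A^(p^m-1) equals N^(p^m-1) in characteristic p; it vanishes, and
    [corank_exp] applies. *)
Let dimV : (logn p #|V| <= (p ^ m).-1 * b)%N.
Proof.
have := corank_exp N (p ^ m).-1.
have -> : (N ^+ (p ^ m).-1 = 0)%R.
  have := congr1 (horner_mx A) (geometric_sum_pchar m (pchar_Fp p_pr)).
  rewrite rmorphXn rmorphB rmorph1 /= horner_mx_X => ->.
  rewrite rmorph_sum -[RHS]norm0 /=; apply: eq_bigr => i _.
  by rewrite rmorphXn /= horner_mx_X.
by rewrite mxrank0 add0n -(dim_abelemE abelV ntV) /b mxrank_coker.
Qed.

(** The columns of [C] form a basis of the x-invariant functionals on [V]. The other factor of
    [cokermx N] has full row rank and can be cancelled. *)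
Let NC : (N *m C = 0)%R.
Proof.
have : (N *m C *m row_base (cokermx N) = 0)%R.
  by rewrite -mulmxA mulmx_base mulmx_coker.
move/(congr1 (mulmxr (pinvmx (row_base (cokermx N))))).
by rewrite /= mulmxKp ?row_base_free // mul0mx.
Qed.

Let ECx v n : v \in V -> (E (v ^ (x ^+ n)) *m C = E v *m C)%R.
Proof.
move=> Vv; elim: n => [|n IH]; first by rewrite conjg1.
have Vn : v ^ x ^+ n \in V by rewrite memJ_norm // groupX.
rewrite expgSr conjgM EJ // -IH.
by apply/subr0_eq; rewrite -mulmxBl -{2}[E _]mulmx1 -mulmxBr -mulmxA NC mulmx0.
Qed.

(** [kap] sends [v * x ^+ i] to the values of the invariant functionals at [v], followed by [i]
    modulo p. Invariance makes it additive on the semidirect product. *)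
Lemma split_hom : exists b' (kap : Q -> 'rV['F_p]_(b' + 1)),
  [/\ {in X <*> V &, forall y z, kap (y * z) = (kap y + kap z)%R},
      (<<[seq kap y | y in X <*> V]>> = fullv)%VS &
      (logn p #|V| <= (p ^ m).-1 * b')%N].
Proof.
have [idx idxP] : {idx : Q -> nat | forall y, y \in X -> y = x ^+ idx y}.
  exists (fun y => if [pick i : 'I_#[x] | y == x ^+ i] is Some i then i : nat else 0%N) => y.
  case/cycleP => i ->; case: pickP => [j /eqP //|/(_ (Ordinal (ltn_pmod i (order_gt0 x)))) /=].
  by rewrite expg_mod_order eqxx.
(* The exponent of [x] is determined modulo p^m only; as [m > 0], its residue modulo p is well
   defined. *)
pose log y := ((idx y)%:R : 'F_p)%R.
have logX i : log (x ^+ i) = (i%:R)%R.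
  have /eqP := idxP _ (mem_cycle x i); rewrite eq_expg_mod_order ox => /eqP e.
  apply/val_inj; rewrite /log /= !val_Fp_nat ?prime_gt1 //.
  have dvd : p %| p ^ m by rewrite dvdn_exp.
  by rewrite -(modn_dvdm _ dvd) -e modn_dvdm.
have sdK : V ><| X = X <*> V by rewrite joingC sdprodEY.
have [_ defK _ _] := sdprodP sdK.
pose kap y := row_mx (E (divgr V X y) *m C)%R (const_mx (log (remgr V X y))) : 'rV['F_p]_(b + 1).
have kapE v i : v \in V -> kap (v * x ^+ i) = row_mx (E v *m C)%R (const_mx (i%:R)%R).
  by move=> Vv; rewrite /kap (divgrMid tiVx) ?(remgrMid tiVx) ?mem_cycle // logX.
exists b, kap; split; last exact: dimV.
  move=> y z; rewrite -defK => /mulsgP[v _ Vv /cycleP[i ->] ->] /mulsgP[w _ Vw /cycleP[j ->] ->].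
  have -> : v * x ^+ i * (w * x ^+ j) = (v * w ^ (x ^+ i)^-1) * x ^+ (i + j).
    by rewrite expgnDr conjgE invgK !mulgA mulgKV.
  have Vwx : w ^ (x ^+ i)^-1 \in V by rewrite memJ_norm // groupV groupX.
  rewrite (kapE _ _ (groupM Vv Vwx)) !kapE //.
  apply: etrans (esym (add_row_mx _ _ _ _)).
  rewrite abelem_rV_M // mulmxDl natrD.
  congr row_mx; last by apply/matrixP => ? ?; rewrite !mxE.
  by rewrite -(ECx i Vwx) conjgKV.
apply/vspaceP => u; rewrite memvf.
rewrite -[u]hsubmxK.
have [w wE] : exists w, lsubmx u = (w *m C)%R.
  exists (lsubmx u *m pinvmx C)%R; rewrite mulmxKpV // submx_full // .
  exact: col_base_full.
pose v := rVabelem abelV ntV w.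
have Vv : v \in V by apply: mem_rVabelem.
have -> : row_mx (lsubmx u) (rsubmx u) = (kap v + rsubmx u 0 0 *: kap x)%R.
  have := kapE v 0%N Vv; have := kapE 1 1%N (group1 V); rewrite mul1g mulg1 expg1 => -> ->.
  rewrite abelem_rV_1 mul0mx scale_row_mx scaler0 add_row_mx addr0 wE rVabelemK.
  congr row_mx; apply/rowP => i; rewrite !mxE add0r mulr1; by rewrite (ord1 i).
apply: rpredD; last apply: rpredZ; apply/memv_span/image_f.
  by rewrite mem_gen // inE Vv orbT.
by rewrite mem_gen // inE cycle_id.
Qed.

End SplitHom.

(** [schreier_bound] for K = <x>V and a target of dimension b + 1 gives b <= |L : K| (|l| - 1).
    Combine with dim V <= (p^m - 1) b and |K| = p^m |V|. *)
Lemma abelem_logn_bound p (Q : finGroupType) (l : seq Q) (V : {group Q}) x m :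
    prime p -> p.-abelem V -> x \in 'N(V) -> (0 < m)%N -> V :&: <[x]> = 1 ->
    (forall v, v \in V -> (x * v) ^+ (p ^ m) = 1) -> #[x] = (p ^ m)%N ->
    x \in <<[set y in l]>> -> V \subset <<[set y in l]>> ->
  (logn p #|V| * (p ^ m * #|V|) <=
     (p ^ m).-1 * (#|<<[set y in l]>>| * (size l).-1))%N.
Proof.
move=> p_pr abelV nVx m_gt0 tiVx xvX ox Lx sVL.
case: (eqVneq (gval V) 1) => [->|ntV]; first by rewrite cards1 logn1.
have [b [kap [kapM kapS Vb]]] := split_hom p_pr abelV ntV nVx m_gt0 tiVx xvX ox.
set L := <<_>>; have sKL : <[x]> <*> V \subset L by rewrite join_subG cycle_subG Lx.
have := schreier_bound sKL kapM kapS; rewrite dimvf /dim /= mul1n -/L => bound.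
have cK : #|<[x]> <*> V| = (p ^ m * #|V|)%N.
  by rewrite joingC norm_joinEr ?cycle_subG // TI_cardMg // -ox mulnC.
rewrite -cK -(Lagrange sKL).
have b_le : (b <= #|L : <[x]> <*> V| * (size l).-1)%N.
  by case: (size l) bound => [|k]; rewrite /= ?mulnS; lia.
apply: leq_trans (leq_mul Vb (leqnn _)) _.
rewrite -mulnA leq_mul2l; apply/orP; right.
by rewrite -mulnA mulnC leq_mul2l b_le orbT.
Qed.

(** * Free groups *)

Section FreeGroup.
Variable r : nat.
Local Notation W := (seq (bool * 'I_r)).

Definition word_eval (K : group) (f : 'I_r -> gcar K) (w : W) : gcar K :=
  \prod_(s <- w) (if s.1 then (f s.2)^-1 else f s.2).

Definition word_inv (w : W) : W := rev [seq (~~ s.1, s.2) | s <- w].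

Lemma word_eval_cat (K : group) (f : 'I_r -> gcar K) u v :
  word_eval f (u ++ v) = word_eval f u * word_eval f v.
Proof. exact: big_cat. Qed.

Lemma word_eval1 (K : group) (f : 'I_r -> gcar K) b i :
  word_eval f [:: (b, i)] = if b then (f i)^-1 else f i.
Proof. exact: big_seq1. Qed.

Lemma word_eval_inv (K : group) (f : 'I_r -> gcar K) w :
  word_eval f (word_inv w) = (word_eval f w)^-1.
Proof.
elim: w => [|[b i] w IH]; first by rewrite /word_eval !big_nil invg1.
rewrite /word_inv /= rev_cons -cats1 -(cat1s (b, i)) !word_eval_cat invMg.
by rewrite -/(word_inv w) IH !word_eval1; case: b; rewrite ?invgK.
Qed.

(** Words are identified when they agree under every evaluation in every group, so the universal
    property is immediate and no reduced words are needed. *)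
Lemma free_group : exists (F : group) (x : 'I_r -> gcar F),
  (forall g, gen (fun y => exists i, y = x i) g) /\
  forall (K : group) (f : 'I_r -> gcar K), exists phi : gcar F -> gcar K,
    {morph phi : y z / y * z} /\ forall i, phi (x i) = f i.
Proof.
have [||||||w|F [pi [piM piS piE]]] := @setoid_group W cat [::] word_inv
  (fun u v => forall (K : group) (f : 'I_r -> gcar K), word_eval f u = word_eval f v).
- by [].
- by move=> u v uv K f; rewrite uv.
- by move=> u v w uv vw K f; rewrite uv.
- by move=> u u' v v' uu vv K f; rewrite !word_eval_cat uu vv.
- by move=> u v w K f; rewrite catA.
- by [].
- move=> K f; rewrite word_eval_cat word_eval_inv mulVg.
  by rewrite /word_eval big_nil.
exists F, (fun i => pi [:: (false, i)]); split=> [g|K f].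
  have [w <-] := piS g; set S := fun y => _; have sS := gen_sg S.
  have pi1 : pi [::] = 1 by apply: (mulgI (pi [::])); rewrite -piM mulg1.
  elim: w => [|[b i] w IH]; first by rewrite pi1; exact: sg1.
  rewrite -cat1s piM; apply: (sgM sS) => //.
  have Si : gen S (pi [:: (false, i)]) by apply: gen_in; exists i.
  case: b => //; have -> : pi [:: (true, i)] = (pi [:: (false, i)])^-1.
    apply: (mulgI (pi [:: (false, i)])); rewrite -piM mulgV -pi1; apply/piE => K f.
    by rewrite -cat1s word_eval_cat !word_eval1 mulgV /word_eval big_nil.
  exact: (sgV sS).
have /choice[rep repK] := piS.
exists (fun g => word_eval f (rep g)); split=> [y z|i].
  have /piE-> : pi (rep (y * z)) = pi (rep y ++ rep z) by rewrite piM !repK.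
  exact: word_eval_cat.
have /piE-> : pi (rep (pi [:: (false, i)])) = pi [:: (false, i)] by rewrite repK.
exact: word_eval1.
Qed.

End FreeGroup.

Section FreeRank.
Variables (r : nat) (F : group) (x : 'I_r -> gcar F).
Local Notation T := (gcar F).
Hypothesis genF : forall g, gen (fun y => exists i, y = x i) g.
Hypothesis univF : forall (K : group) (f : 'I_r -> gcar K),
  exists phi : T -> gcar K, {morph phi : y z / y * z} /\ forall i, phi (x i) = f i.
Variables (H : T -> Prop) (n : nat) (c : T -> 'I_n) (rho : 'I_n -> T).
Hypothesis sH : is_subgroup H.
Hypothesis cK : forall i, c (rho i) = i.
Hypothesis cP : forall g g', c g = c g' <-> H (g^-1 * g').
Let act g v := c (g * rho v).

Let cM g h : c (g * h) = act g (c h).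
Proof. by apply/cP; rewrite invMg -mulgA mulKg; apply/cP; rewrite cK. Qed.

Let actM g h v : act (g * h) v = act g (act h v).
Proof. by rewrite {1}/act -mulgA cM. Qed.

Let act1 v : act 1 v = v.
Proof. by rewrite /act mul1g cK. Qed.

(* D is the first component of the homomorphism F -> A^n x| F sending x_i to (a i, x_i). *)
Lemma free_derivation (A : zmodType) (a : 'I_r -> 'I_n -> A) :
  exists D : T -> 'I_n -> A,
    (forall g h v, D (g * h) v = (D g (act h v) + D h v)%R) /\
    (forall i v, D (x i) v = a i v).
Proof.
pose C := (('I_n -> A) * T)%type.
pose m (u v : C) : C := ((fun i => u.1 (act v.2 i) + v.1 i)%R, u.2 * v.2).
pose inv (u : C) : C := ((fun i => - u.1 (act u.2^-1 i))%R, u.2^-1).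
have mA u v w : m u (m v w) = m (m u v) w.
  congr (_, _); last exact: mulgA.
  by apply/funext => i; rewrite /= actM addrA.
have m1 u : m ((fun=> 0%R), 1) u = u.
  by case: u => f g; congr (_, _); rewrite /= ?mul1g //; apply/funext => i; rewrite add0r.
have mV u : m (inv u) u = ((fun=> 0%R), 1).
  congr (_, _); last exact: mulVg.
  by apply/funext => i; rewrite /= -actM mulVg act1 addNr.
have [phi [phiM phix]] := univF (K := @Defs.Group C m _ inv mA m1 mV) (fun i => (a i, x i)).
have phi2 g : (phi g).2 = g.
  apply: (gen_le (K := fun g => (phi g).2 = g) _ _ (genF g)) => [|_ [i ->]]; last first.
    by rewrite phix.
  apply: is_subgroupI => [|y z yE zE|y yE]; first by rewrite (quo1 phiM).
    by rewrite phiM /= yE zE.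
  by rewrite (quoV phiM) /= yE.
exists (fun g => (phi g).1); split=> [g h v|i v]; last by rewrite phix.
by rewrite phiM /= phi2.
Qed.

(** The lower half of Schreier's index formula, d_p(H) >= (r - 1) n + 1, without subtraction. *)
Lemma free_rank_bound p (l : seq T) : prime p -> gens_mod p H l ->
  (r * n + 1 <= size l + n)%N.
Proof.
move=> p_pr [lH Hl].
(* The universal derivation: its values D(x_i, v) are a basis of the matrix space, which is
   also spanned by the D(y, v0) for y in l and the D(rho v, v0) for v <> v0. *)
have [D [DM Dx]] := @free_derivation 'M['F_p]_(r, n) (fun i v => delta_mx i v).
pose v0 := c 1.
have actH h : H h -> act h v0 = v0.
  by move=> Hh; rewrite /v0 -cM mulg1; apply/cP; rewrite mulg1; apply: sgV.
have D1 v : D 1 v = 0%R.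
  by apply: (addrI (D 1 v)); rewrite -{1}[in LHS](act1 v) -DM mulg1 addr0.
pose d h := D h v0.
have dM g h : H h -> d (g * h) = (d g + d h)%R.
  by move=> Hh; rewrite /d DM actH.
have dV h : H h -> d h^-1 = (- d h)%R.
  by move=> Hh; apply/eqP; rewrite -addr_eq0 -dM // mulVg /d D1.
have dX h k : H h -> d (h ^+ k) = (d h *+ k)%R.
  move=> Hh; elim: k => [|k IH]; first by rewrite /d D1 mulr0n.
  by rewrite expgSr dM // IH mulrSr.
pose S1 := [seq d y | y <- l].
pose S2 := [seq d (rho v) | v <- enum 'I_n & v != v0].
(* On [H] the map [d] is a homomorphism to an elementary abelian p-group, so it kills Phi(H). *)
have dS h : H h -> d h \in <<S1>>%VS.
  move=> Hh; suff [] : H h /\ d h \in <<S1>>%VS by [].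
  apply: (Hl h Hh (fun h => H h /\ d h \in <<S1>>%VS)).
    apply: is_subgroupI => [|y z [Hy yS] [Hz zS]|y [Hy yS]].
    - by split; [apply: sg1 | rewrite /d D1 mem0v].
    - by split; [apply: sgM | rewrite dM // memvD].
    - by split; [apply: sgV | rewrite dV // memvN].
  move=> y [ly|Phiy].
    split; first exact: lH.
    by apply/memv_span/map_f/InE.
  suff [Hy ->] : H y /\ d y = 0%R by split=> //; apply: mem0v.
  apply: (frattini_le (K := fun y => H y /\ d y = 0%R) _ _ _ Phiy) => [|y1 y2 H1 H2|y1 H1].
  - apply: is_subgroupI => [|y1 y2 [H1 e1] [H2 e2]|y1 [H1 e1]].
    + by split; [apply: sg1 | rewrite /d D1].
    + by split; [apply: sgM | rewrite dM // e1 e2 addr0].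
    + by split; [apply: sgV | rewrite dV // e1 oppr0].
  - have [H1' H2'] := (sgV sH H1, sgV sH H2).
    have H12 := sgM sH H1 H2.
    have HJ := sgM sH H2' H12.
    split; rewrite commgEl conjgE; first exact: sgM.
    by rewrite (dM _ _ HJ) (dM _ _ H12) (dM _ _ H2) !dV // addrCA addKr addNr.
  - split; first exact: sgX.
    by rewrite dX // -scaler_nat pchar_Fp_0 // scale0r.
have rhoS v : d (rho v) \in <<S1 ++ S2>>%VS.
  case: (eqVneq v v0) => [->|nv].
    apply: (subvP (sub_span _)) (dS _ _) => [y|]; first by rewrite mem_cat => ->.
    have /cP : c 1 = c (rho v0) by rewrite cK.
    by rewrite invg1 mul1g.
  apply: memv_span; rewrite mem_cat; apply/orP; right; apply: map_f.
  by rewrite mem_filter nv mem_enum.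
have full : <<S1 ++ S2>>%VS = fullv.
  apply/vspaceP => u; rewrite memvf (matrix_sum_delta u).
  apply: rpred_sum => i _; apply: rpred_sum => v _; apply: rpredZ.
  have ev : act (rho v) v0 = v by rewrite /v0 -cM mulg1 cK.
  (* As [rho v] moves v0 to v, the cocycle rule isolates the value of the derivation at (x_i, v). *)
  have -> : delta_mx i v = (d (x i * rho v)%g - d (rho v))%R.
    by rewrite /d DM ev Dx addrK.
  apply: rpredB => //.
  set w := c (x i * rho v).
  have Hw : H ((rho w)^-1 * (x i * rho v)) by apply/cP; rewrite cK.
  rewrite -(mulKVg (rho w) (x i * rho v)) dM //; apply: rpredD => //.
  by apply: (subvP (sub_span _)) (dS _ Hw) => y; rewrite mem_cat => ->.
have := dim_span (S1 ++ S2); rewrite full dimvf /dim /= size_cat !size_map.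
(* Leaving v0 out of [S2] accounts for the summand 1 in the bound. *)
have -> : size [seq v <- enum 'I_n | v != v0] = n.-1.
  have := cardC1 v0; rewrite card_ord => <-; rewrite cardE; congr size.
  by rewrite enumT; apply: eq_filter.
by have := ltn_ord v0; lia.
Qed.

End FreeRank.

(** * Generation modulo relators *)

Lemma has_index_uniq (G : group) (H : gcar G -> Prop) n n' : is_subgroup H ->
  has_index H n -> has_index H n' -> n = n'.
Proof.
move=> sH; wlog le_nn' : n n' / (n' <= n)%N => [IH indn indn'|].
  by case/orP: (leq_total n n') => le; [symmetry|]; apply: IH.
move=> /(has_indexP _ sH)[c [rho [cK cP]]] /(has_indexP _ sH)[c' [rho' [cK' cP']]].
apply/eqP; rewrite eqn_leq le_nn' andbT -(card_ord n) -(card_ord n').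
apply: (@leq_card _ _ (fun i => c' (rho i))) => i j /cP'/cP.
by rewrite !cK.
Qed.

Section RelativeGeneration.
Variables (G : group) (p : nat).
Local Notation T := (gcar G).
Implicit Types (H N M : T -> Prop) (l cl : seq T).
Local Notation Phi := (frattini_p p).

(** For a normal subgroup [N] inside [H], this is generation of H/N modulo its Frattini subgroup,
    expressed without leaving the ambient group. *)
Definition gens_rel H N l : Prop :=
  (forall x, x \in l -> H x) /\
  forall h, H h -> gen (fun x => [\/ x \in l, Phi H x | N x]) h.

Definition conjs N : T -> Prop := fun x => exists y t, N y /\ x = y ^ t.

Lemma gens_rel0 H l : gens_rel H (fun=> False) l <-> gens_mod p H l.
Proof.
split=> -[lH Hl]; split=> [x /InE /lH //|h /Hl];
  apply: gen_mono => x.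
- by case=> // [/InE|]; [left | right].
- by case=> [/InE|]; [apply: Or31 | apply: Or32].
Qed.

Lemma gens_rel_cat H N M l cl : (forall x, x \in cl -> H x) ->
  (forall x, M x -> gen (fun y => y \in cl \/ Phi H y) x) ->
  gens_rel H (fun x => N x \/ M x) l -> gens_rel H N (l ++ cl).
Proof.
move=> clH Mcl [lH Hl]; split=> [x|h /Hl].
  by rewrite mem_cat => /orP[/lH|/clH].
apply: gen_le; first exact: gen_sg.
move=> x [lx|Px|[Nx|/Mcl]].
- by apply: gen_in; apply: Or31; rewrite mem_cat lx.
- by apply: gen_in; apply: Or32.
- by apply: gen_in; apply: Or33.
apply: gen_mono => y [cly|Py]; last exact: Or32.
by apply: Or31; rewrite mem_cat cly orbT.
Qed.

Lemma gens_rel_mono H N M l : (forall x, N x -> gen (fun y => Phi H y \/ M y) x) ->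
  gens_rel H N l -> gens_rel H M l.
Proof.
move=> NM [lH Hl]; split=> // h /Hl; apply: gen_le; first exact: gen_sg.
move=> x [lx|Px|/NM]; [by apply: gen_in; apply: Or31|by apply: gen_in; apply: Or32|].
by apply: gen_mono => y [?|?]; [apply: Or32 | apply: Or33].
Qed.

Hypothesis p_pr : prime p.

(* If g has order p^k modulo H, then conjugates of g^(p^k) by elements of the same
   right coset of <g>H agree modulo Phi(H); if the order is smaller, g^(p^k) is a
   p-th power in H. *)
Lemma power_conj_cost H a g k : is_normal H -> has_index H (p ^ a)%N ->
    H (g ^+ (p ^ k)) ->
  exists cl : seq T, [/\ (size cl * p ^ k <= p ^ a)%N, forall x, x \in cl -> H x &
    forall t, gen (fun x => x \in cl \/ Phi H x) ((g ^+ (p ^ k)) ^ t)].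
Proof.
move=> nH indH Hgk; have sH := nsg nH.
have [/andP[k_gt0 /asboolP Hg1]|nHg1] := boolP ((0 < k)%N && `[< H (g ^+ (p ^ k.-1)) >]).
  exists [::]; split=> // t; apply: gen_in; right; apply: (nsgJ t (frattini_normal p nH)).
  rewrite -(prednK k_gt0) expnSr expgnA; exact: frattini_pow.
have [Q [q [qM qS qK cQ pQ]]] := pquotient p_pr nH indH.
pose X := <[q g]>.
have cX : #|X| = (p ^ k)%N.
  have : q g ^+ (p ^ k) == 1 by rewrite -(quoX qM); apply/eqP/qK.
  rewrite -order_dvdn; case/(dvdn_pfactor _ _ p_pr) => j le_jk oj.
  move: le_jk; rewrite leq_eqVlt => /predU1P[<- //|lt_jk].
  case/negP: nHg1; rewrite (leq_ltn_trans _ lt_jk) //=; apply/asboolP/qK.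
  rewrite (quoX qM); apply/eqP; rewrite -order_dvdn oj dvdn_exp2l //.
  by rewrite -ltnS prednK // (leq_ltn_trans _ lt_jk).
have /choice[r rP] (C : {set Q}) : exists t, q t = repr C by apply: qS.
exists [seq (g ^+ (p ^ k)) ^ r C | C <- enum (rcosets X [set: Q])]; split.
- rewrite size_map -cardE -cX mulnC -[X in (_ <= X)%N]cQ -cardsT.
  by rewrite -[#|rcosets _ _|]/#|[set: Q] : X| Lagrange ?subsetT.
- by move=> _ /mapP[C _ ->]; apply: nsgJ.
move=> t; set S := fun x => _; have sS := gen_sg S.
pose C := X :* q t.
have : repr C \in X :* q t by apply: mem_repr (rcoset_refl X (q t)).
case/rcosetP => _ /cycleP[i ->] rC.
have Hh : H ((g ^+ i * t)^-1 * r C).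
  apply/qK; rewrite qM (quoV qM) qM (quoX qM) rP rC; exact: mulVg.
set h := _ * _ in Hh.
have rCE : r C = g ^+ i * t * h by rewrite /h mulKVg.
set z := (g ^+ (p ^ k)) ^ t.
have Hz : H z by apply: nsgJ.
have zh : z ^ h = (g ^+ (p ^ k)) ^ r C.
  have gi : (g ^+ (p ^ k)) ^ (g ^+ i) = g ^+ (p ^ k).
    by apply/conjg_fixP/commgP; apply: commuteX2.
  by rewrite rCE (conjgM _ (g ^+ i * t) h) (conjgM _ (g ^+ i) t) gi.
(* Conjugation by [h] in [H] changes [z] only by a commutator, which lies in Phi(H). *)
have -> : z = z ^ h * [~ z, h]^-1 by rewrite commgEl invMg invgK mulKVg.
apply: (sgM sS); last apply: (sgV sS).
  rewrite zh; apply: gen_in; left; apply: map_f.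
  by rewrite mem_enum /C mem_rcosets mulSGid ?inE ?subsetT.
by apply: gen_in; right; apply: frattini_comm.
Qed.

End RelativeGeneration.

(** * Positive p-gradient and the exponent *)

Lemma INR_muln m n : INR (m * n)%N = (INR m * INR n)%Re.
Proof. by rewrite -multE mult_INR. Qed.

Lemma INR_addn m n : INR (m + n)%N = (INR m + INR n)%Re.
Proof. by rewrite -plusE plus_INR. Qed.

Lemma INR_subn m n : (n <= m)%N -> INR (m - n)%N = (INR m - INR n)%Re.
Proof. by move=> le_nm; rewrite -minusE minus_INR //; apply/leP. Qed.

Section FrattiniQuotient.
Variables (G : group) (p : nat) (Q : finGroupType) (q : gcar G -> Q).
Hypothesis p_pr : prime p.
Hypothesis qM : {morph q : x y / x * y}.
Hypothesis qS : forall z, exists x, q x = z.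

Lemma quo_abelem (H : gcar G -> Prop) (V : {group Q}) : is_subgroup H ->
  (forall x, q x = 1 <-> frattini_p p H x) -> (forall x, q x \in V <-> H x) ->
  p.-abelem V.
Proof.
move=> sH qK qV; apply/abelemP => //; split=> [|z Vz].
  apply/centsP => y Vy z Vz; have [[u uy] [v vz]] := (qS y, qS z).
  apply/commgP; rewrite -uy -vz -(quoR qM); apply/eqP/qK.
  by apply: frattini_comm; apply/qV; rewrite ?uy ?vz.
have [u uz] := qS z; rewrite -uz -(quoX qM); apply/qK.
by apply: frattini_pow; apply/qV; rewrite uz.
Qed.

Lemma quo_gens (H : gcar G -> Prop) (V : {group Q}) : is_subgroup H ->
  (forall x, q x = 1 <-> frattini_p p H x) -> (forall x, q x \in V <-> H x) ->
  exists l, gens_mod p H l /\ size l = logn p #|V|.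
Proof.
move=> sH qK qV; have abelV := quo_abelem sH qK qV.
have [B genB cB] := grank_witness V.
have [r rP] := choice qS.
have rH z : z \in B -> H (r z).
  by move=> Bz; apply/qV; rewrite rP -genB mem_gen.
exists [seq r z | z <- enum B]; split; last first.
  rewrite size_map -cardE cB (grank_abelian (abelem_abelian abelV)).
  exact: rank_abelem abelV.
apply/gens_rel0; split=> [_ /mapP[z + ->]|h Hh].
  by rewrite mem_enum => /rH.
set S := fun x => _; have sS := gen_sg S.
have : q h \in <<B>> by rewrite genB; apply/qV.
move=> /(@gen_lift G Q q qM S) [z Bz|y [Sy qy]].
  exists (r z); split=> //; apply: Or31; apply: map_f; by rewrite mem_enum.
rewrite -(mulKVg y h); apply: (sgM sS Sy); apply: gen_in; apply: Or32.
by apply/qK; rewrite qM (quoV qM) qy mulVg.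
Qed.

(** Burnside's basis theorem: the image of Phi(L) lies in the Frattini subgroup of the p-group [M],
    whose elements are non-generators. *)
Lemma quo_generated (L : gcar G -> Prop) l (M : {group Q}) :
  p.-group [set: Q] -> is_subgroup L -> (forall x, q x \in M <-> L x) ->
  gens_mod p L l -> <<[set y in map q l]>> = M.
Proof.
move=> pQ sL qL /gens_rel0 [lL Ll].
have pM : p.-group M := pgroupS (subsetT M) pQ.
apply: (@Phi_nongen _ M); apply/eqP; rewrite eqEsubset; apply/andP; split.
  rewrite join_subG Phi_sub; apply/subsetP => z; rewrite inE => /mapP[x lx ->].
  exact/qL/lL.
apply/subsetP => z Mz; have [x xz] := qS z; rewrite -xz.
apply: (gen_quo qM _ (Ll x _)) => [y [ly|Py|//]|]; last by apply/qL; rewrite xz.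
  by apply: mem_gen; rewrite inE; apply/orP; right; rewrite inE map_f.
apply: (subsetP (joing_subl _ _)); rewrite (Phi_joing pM).
apply: (frattini_le (K := fun y => q y \in M^`(1) <*> 'Mho^1(M)) _ _ _ Py) => [|u v Lu Lv|u Lu].
- exact: preim_sg.
- rewrite (quoR qM); apply: (subsetP (joing_subl _ _)).
  by apply: mem_commg; apply/qL.
- rewrite (quoX qM); apply: (subsetP (joing_subr _ _)).
  have Mu : q u \in M by apply/qL.
  by have := Mho_p_elt 1 Mu (mem_p_elt pM Mu); rewrite expn1.
Qed.

End FrattiniQuotient.

(** Says that [d] is a lower bound for the p-gradient, with denominators cleared and arbitrary
    generating lists in place of minimal ones. *)
Definition rank_lower_bound p (G : group) (d : R) : Prop :=
  forall H a l, is_normal H -> has_index H (p ^ a)%N -> @gens_mod G p H l ->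
    (d * INR (p ^ a)%N + 1 <= INR (size l))%Re.

Section UnboundedExponent.
Variables (G : group) (p : nat).
Hypotheses (p_pr : prime p) (fgG : finitely_generated G).
Local Notation T := (gcar G).
Implicit Types H L : T -> Prop.

Definition order_mod H (x : T) m :=
  H (x ^+ (p ^ m)) /\ forall j, (j < m)%N -> ~ H (x ^+ (p ^ j)).

Lemma order_mod_lift H a x v m : is_normal H -> has_index H (p ^ a)%N ->
  order_mod H x m -> H v -> ~ frattini_p p H ((x * v) ^+ (p ^ m)) ->
  order_mod (frattini_p p H) (x * v) m.+1.
Proof.
move=> nH indH [Hx nHx] Hv nPhi; have sH := nsg nH.
have [Q [q [qM qS qK _ _]]] := pquotient p_pr nH indH.
have HX n : H ((x * v) ^+ n) <-> H (x ^+ n).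
  by rewrite -!qK !(quoX qM) qM (proj2 (qK v) Hv) mulg1.
split=> [|j]; first by rewrite expnSr expgnA; apply: frattini_pow; apply/HX.
rewrite ltnS leq_eqVlt => /predU1P[-> //|lt_jm] /(frattini_sub sH) /HX.
exact: nHx.
Qed.

Lemma order_mod_quo (Q : finGroupType) (q : T -> Q) H (V : {group Q}) x m :
  {morph q : x y / x * y} -> (forall z, q z \in V <-> H z) ->
  order_mod H x m -> q x ^+ (p ^ m) = 1 -> #[q x] = (p ^ m)%N /\ V :&: <[q x]> = 1.
Proof.
move=> qM qV [_ nHx] qxm.
have nV j : (j <= m)%N -> q x ^+ (p ^ j) \in V -> j = m.
  rewrite leq_eqVlt => /predU1P[// | lt_jm].
  by rewrite -(quoX qM) => /qV /(nHx j lt_jm).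
have pm_gt0 : (0 < p ^ m)%N by rewrite expn_gt0 prime_gt0.
split.
  have : #[q x] %| p ^ m by rewrite order_dvdn qxm.
  case/(dvdn_pfactor _ _ p_pr) => j le_jm oj; rewrite oj (nV j le_jm) //.
  by rewrite -oj expg_order group1.
apply/trivgP/subsetP => z /setIP[Vz /cycleP[i zE]]; rewrite zE in Vz *; rewrite inE.
(* By Bezout, a power of [q x] in [V] with exponent [i] brings in the one with exponent gcd(p^m, i)
   = p^j, which forces j = m. *)
have [e _ /dvdnP[f fE]] := Bezoutl i pm_gt0.
have /(dvdn_pfactor _ _ p_pr)[j le_jm jE] := dvdn_gcdl (p ^ m) i.
have : q x ^+ (p ^ j) \in V.
  rewrite -jE -(mulgK (q x ^+ (e * i)) (q x ^+ _)) -expgnDr fE mulnC expgnA qxm.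
  by rewrite expg1n mul1g groupV mulnC expgnA groupX.
move/(nV j le_jm) => jm; have := dvdn_gcdr (p ^ m) i; rewrite jE jm => /dvdnP[c ->].
by rewrite mulnC expgnA qxm expg1n.
Qed.

(* Let (L, l) nearly attain the infimum d0 of the ratios (|l| - 1) / [G : L], and
   let x in L have the largest possible order p^m modulo a p-power index normal
   subgroup H of G in L. Maximality gives (x v)^(p^m) in Phi(H) for all v in H, so
   abelem_logn_bound makes d(H) - 1 too small by the factor 1 - p^-m. *)
Lemma unbounded_exponent d k : (0 < d)%Re -> rank_lower_bound p G d ->
  ~ (forall g : T, g ^+ (p ^ k) = 1).
Proof.
move=> d_gt0 dG expG.
have p_gt0 : (0 < p)%N := prime_gt0 p_pr.
(* The ratios are negated because [completeness] supplies suprema. *)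
pose S y := exists L s l, [/\ is_normal L, has_index L (p ^ s)%N, gens_mod p L l &
  y = (- ((INR (size l) - 1) / INR (p ^ s)%N))%Re].
have INRp n : (0 < INR (p ^ n)%N)%Re by apply/lt_0_INR/ltP; rewrite expn_gt0 p_gt0.
have Sub : bound S.
  exists (- d)%Re => _ [L [s [l [nL indL gL ->]]]].
  have := dG L s l nL indL gL; have := INRp s; set P := INR _ => P_gt0 dP.
  apply/Ropp_le_contravar; apply: (Rmult_le_reg_r P) => //.
  by rewrite /Rdiv Rmult_assoc Rinv_l; lra.
have S0 : exists y, S y.
  have [l lP] := fgG; eexists; exists (fun=> True), 0%N, l; split; last by [].
  - by apply: is_normalI.
  - apply/has_indexP => //; exists (fun=> ord0), (fun=> 1); split=> // i.
    by apply: val_inj; case: i => -[].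
  - split=> // h _; apply: gen_mono (lP h) => x; by left.
have [md [md_ub md_lub]] := completeness S Sub S0.
pose d0 := (- md)%Re.
have d0_gt0 : (0 < d0)%Re.
  suff : (md <= - d)%Re by rewrite /d0; lra.
  apply: md_lub => _ [L [s [l [nL indL gL ->]]]].
  have := dG L s l nL indL gL; have := INRp s; set P := INR _ => P_gt0 dP.
  apply/Ropp_le_contravar; apply: (Rmult_le_reg_r P) => //.
  by rewrite /Rdiv Rmult_assoc Rinv_l; lra.
have d0G : rank_lower_bound p G d0.
  move=> H a l nH indH gH; have := INRp a; set P := INR (p ^ a)%N => P_gt0.
  have le : (- ((INR (size l) - 1) / P) <= md)%Re by apply: md_ub; exists H, a, l.
  have -> : INR (size l) = ((INR (size l) - 1) / P * P + 1)%Re by field; lra.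
  suff : (d0 * P <= (INR (size l) - 1) / P * P)%Re by lra.
  by apply: Rmult_le_compat_r; rewrite /d0; lra.
(* The slack 1 + p^-k is fixed before m is known. As m <= k, it cannot make up for the loss 1 -
   p^-m. *)
have [L [s [l [nL indL gL l_lt]]]] : exists L s l, [/\ is_normal L,
    has_index L (p ^ s)%N, gens_mod p L l &
    (INR (size l) - 1 < d0 * (1 + / INR (p ^ k)%N) * INR (p ^ s)%N)%Re].
  have lt_d0 : (d0 < d0 * (1 + / INR (p ^ k)%N))%Re.
    have := Rinv_0_lt_compat _ (INRp k); set e := Rinv _ => e_gt0.
    by have := Rmult_lt_0_compat _ _ d0_gt0 e_gt0; lra.
  have [[y [Sy lt_y]]|nS] := EM (exists y, S y /\ (- (d0 * (1 + / INR (p ^ k)%N)) < y)%Re).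
    case: Sy lt_y => L [s [l [nL indL gL ->]]] lt_y; exists L, s, l; split=> //.
    have := INRp s; move: lt_y; set P := INR (p ^ s)%N => lt_y P_gt0.
    have -> : (INR (size l) - 1 = (INR (size l) - 1) / P * P)%Re by field; lra.
    by apply: Rmult_lt_compat_r => //; lra.
  have : (md <= - (d0 * (1 + / INR (p ^ k)%N)))%Re.
    apply: md_lub => y Sy; apply: Rnot_lt_le => lt_y; apply: nS; by exists y.
  have -> : md = (- d0)%Re by rewrite /d0; lra.
  by move=> le; exfalso; lra.
have sL := nsg nL.
pose P m := `[< exists H x, [/\ pnormal p H, forall z, H z -> L z, L x & order_mod H x m] >].
have pL : pnormal p L by split=> //; exists s; rewrite NatpowE.
have P0 : P 0%N.
  apply/asboolP; exists L, 1; split=> //; first exact: sg1.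
  by split=> //; rewrite expg1n; apply: sg1.
have Pk m : P m -> (m <= k)%N.
  case/asboolP => H [x [[nH _] _ _ [_ nHx]]]; rewrite leqNgt; apply/negP => /nHx.
  by rewrite expG; apply; apply: sg1 (nsg nH).
have [m /asboolP[H [x [pH sHL Lx xm]]] max_m] := ex_maxnP (ex_intro _ 0%N P0) Pk.
have m_le_k : (m <= k)%N by apply: Pk; apply/asboolP; exists H, x.
have [nH [a]] := pH; rewrite NatpowE => indH; have sH := nsg nH.
have pPhi := frattini_pnormal p_pr fgG pH.
have nPhi := nsg (proj1 pPhi).
have xvm v : H v -> frattini_p p H ((x * v) ^+ (p ^ m)).
  move=> Hv; apply: contrapT => nPhiv.
  have /max_m : P m.+1; last by rewrite ltnn.
  apply/asboolP; exists (frattini_p p H), (x * v); split=> //.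
  - by move=> z /(frattini_sub sH) /sHL.
  - by apply: sgM => //; apply: sHL.
  - exact: order_mod_lift indH xm Hv nPhiv.
have [_ [u]] := pPhi; rewrite NatpowE => indPhi.
have [Q [q [qM qS qK cQ pQ]]] := pquotient p_pr (proj1 pPhi) indPhi.
have [V qV] := image_group qM sH (fun z Kz => frattini_sub sH (proj1 (qK z) Kz)).
have [M qL] := image_group qM sL (fun z Kz => sHL _ (frattini_sub sH (proj1 (qK z) Kz))).
have [l0 [gl0 sl0]] := quo_gens p_pr qM qS sH qK qV.
have := d0G _ _ _ nH indH gl0; rewrite sl0 => dV_ge.
have aV := quo_abelem p_pr qM qS sH qK qV.
have index_quo K (B : {group Q}) n : is_subgroup K -> (forall z, q z \in B <-> K z) ->
    has_index K n -> (n * #|B|)%N = (p ^ u)%N.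
  move=> sK qB indK; have := preim_index qM qS B.
  rewrite (_ : (fun z => _) = K); last by apply/funext => z; apply/propext.
  by move=> /(has_index_uniq sK indK)->; rewrite mulnC -cQ -cardsT Lagrange ?subsetT.
have cV := index_quo H V _ sH qV indH.
have cM := index_quo L M _ sL qL indL.
have d0P n : (0 < d0 * INR (p ^ n)%N)%Re by apply: Rmult_lt_0_compat.
(* For m = 0 the maximality puts all of [H] in Phi(H), contradicting the positive lower bound on
   d(H). *)
have [m0|m_gt0] := posnP m.
  have V1 : V :=: 1.
    apply/trivgP/subsetP => z; have [y <-] := qS z => /qV Hy; rewrite inE.
    have Hx : H x by case: xm => + _; rewrite m0 expn0 expg1.
    have := xvm (x^-1 * y); rewrite m0 expn0 expg1 mulKVg => Py.
    by apply/eqP/(qK y); apply: Py; apply: sgM => //; apply: sgV.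
  move: dV_ge; rewrite V1 cards1 logn1 /=; have := d0P a; lra.
have qxm v : v \in V -> (q x * v) ^+ (p ^ m) = 1.
  by have [y <-] := qS v => /qV Hy; rewrite -qM -(quoX qM); apply/(qK _); apply: xvm.
have qx1 : q x ^+ (p ^ m) = 1 by have := qxm 1 (group1 _); rewrite mulg1.
have [oqx tiV] := order_mod_quo qM qV xm qx1.
have genM := quo_generated qM qS pQ sL qL gL.
have nVx : q x \in 'N(V).
  apply/normP/eqP; rewrite eqEcard cardJg leqnn andbT; apply/subsetP => z.
  case/imsetP => w + ->; have [y <-] := qS w => /qV Hy.
  by rewrite -(quoJ qM); apply/(qV _); apply: nsgJ.
have := @abelem_logn_bound p Q (map q l) V (q x) m p_pr aV nVx m_gt0 tiV qxm oqx.
rewrite genM size_map => /(_ (proj2 (qL x) Lx)).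
have sVM : V \subset M by apply/subsetP => z; have [y <-] := qS z => /qV /sHL /qL.
move=> /(_ sVM) bound.
have pu_gt0 : (0 < p ^ u)%N by rewrite expn_gt0 p_gt0.
(* Since p^a |V| = p^u = p^s |M|, the group orders become indices in G after cancelling p^u. *)
have {}bound : (logn p #|V| * p ^ m * p ^ s <= (p ^ m).-1 * p ^ a * (size l).-1)%N.
  rewrite -(leq_pmul2r pu_gt0) -{1}cV -cM.
  have := leq_mul bound (leqnn (p ^ a * p ^ s)).
  by congr (_ <= _)%N; lia.
have l_gt0 : (0 < size l)%N.
  by have := d0G _ _ _ nL indL gL; have := d0P s; case: (size l) => //=; lra.
move/leP/le_INR: bound.
rewrite !INR_muln -!subn1 !INR_subn ?expn_gt0 ?p_gt0 //.
move: l_lt dV_ge (d0P a); have := INRp s; have := INRp a.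
have X_gt1 : (1 < INR (p ^ m)%N)%Re.
  by apply/(lt_INR 1)/ltP; rewrite -(exp1n m) ltn_exp2r // prime_gt1.
have XK : (INR (p ^ m)%N <= INR (p ^ k)%N)%Re.
  by apply/le_INR/leP; rewrite leq_exp2l // prime_gt1.
have := Rinv_0_lt_compat _ (INRp k); have := Rinv_l (INR (p ^ k)%N).
move: X_gt1 XK.
set X := INR (p ^ m)%N; set K := INR (p ^ k)%N; set e := Rinv K.
set A := INR (p ^ a)%N; set Z := INR (p ^ s)%N; set D := INR (logn _ _).
set N := INR (size l) => X_gt1 XK eK e_gt0 A_gt0 Z_gt0 N_lt D_ge dA bound.
have {}eK : (e * K = 1)%Re by apply: eK; lra.
have Xe : (X * e <= 1)%Re.
  by rewrite -eK Rmult_comm; apply: Rmult_le_compat_l; lra.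
have t_gt0 : (0 < d0 * A * Z)%Re by apply: Rmult_lt_0_compat.
have lhs : (d0 * A * Z * X <= D * X * Z)%Re.
  have := Rmult_le_compat_r (X * Z) (d0 * A) D.
  have : (0 <= X * Z)%Re by apply: Rmult_le_pos; lra.
  lra.
have rhs : ((X - 1) * A * (N - 1) <= (X - 1) * A * (d0 * (1 + e) * Z))%Re.
  apply: Rmult_le_compat_l; last by apply: Rlt_le.
  by apply: Rmult_le_pos; lra.
(* Cancelling d0 A Z leaves X <= (X - 1)(1 + e) = X - 1 + X e - e, impossible as X e <= 1 and e >
   0. *)
have : (d0 * A * Z * X <= d0 * A * Z * ((X - 1) * (1 + e)))%Re by simpl in *; lra.
move=> le; have := Rmult_le_reg_l _ _ _ t_gt0 le.
lra.
Qed.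

End UnboundedExponent.

Lemma fg_countable (G : group) : finitely_generated G ->
  exists e : nat -> gcar G, forall g, exists i, e i = g.
Proof.
case=> l lP; pose f (i : 'I_(size l)) : gcar G := nth 1 l i.
exists (fun i => word_eval f (odflt [::] (unpickle i))) => g.
suff [w <-] : exists w, word_eval f w = g by exists (pickle w); rewrite pickleK.
apply: (lP g (fun g => exists w, word_eval f w = g)) => [|x /InE lx].
  apply: is_subgroupI => [|_ _ [u <-] [v <-]|_ [u <-]].
  - by exists [::]; rewrite /word_eval big_nil.
  - by exists (u ++ v); rewrite word_eval_cat.
  - by exists (word_inv u); rewrite word_eval_inv.
have lti : (index x l < size l)%N by rewrite index_mem.
by exists [:: (false, Ordinal lti)]; rewrite word_eval1 /f nth_index.
Qed.

(** * Correspondence between a quotient and the subgroups containing its kernel *)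

Section Transfer.
Variables (F G : group) (f : gcar F -> gcar G) (A : gcar F -> Prop) (p : nat).
Hypothesis fM : {morph f : x y / x * y}.
Hypothesis fS : forall z, exists x, f x = z.
Hypothesis fK : forall x, f x = 1 <-> A x.
Local Notation Phi := (frattini_p p).
Implicit Types (H : gcar F -> Prop) (K : gcar G -> Prop).

Lemma preim_normal K : is_normal K -> is_normal (fun x => K (f x)).
Proof.
move=> nK; have sK := nsg nK; apply: is_normalI => [|h g Kh].
  apply: is_subgroupI => [|x y Kx Ky|x Kx].
  - by rewrite (quo1 fM); apply: sg1.
  - by rewrite fM; apply: sgM.
  - by rewrite (quoV fM); apply: sgV.
by rewrite (quoJ fM); apply: nsgJ.
Qed.

Lemma preim_has_index K n : is_normal K -> has_index K n -> has_index (fun x => K (f x)) n.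
Proof.
move=> nK /(has_indexP _ (nsg nK))[c [rho [cK cP]]].
apply/has_indexP; first exact: nsg (preim_normal nK).
have [r rP] := choice fS.
exists (fun x => c (f x)), (fun i => r (rho i)); split=> [i|x y].
  by rewrite rP cK.
by rewrite cP fM (quoV fM).
Qed.

Definition image_of H : gcar G -> Prop := fun z => exists x, H x /\ f x = z.

Lemma image_ofP H x : is_subgroup H -> (forall y, A y -> H y) -> image_of H (f x) <-> H x.
Proof.
move=> sH sAH; split=> [[y [Hy fxy]]|Hx]; last by exists x.
rewrite -(mulKVg y x); apply: sgM => //; apply: sAH; apply/fK.
by rewrite fM (quoV fM) fxy mulVg.
Qed.

Lemma image_normal H : is_normal H -> is_normal (image_of H).
Proof.
move=> nH; have sH := nsg nH; apply: is_normalI => [|_ g [x [Hx <-]]].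
  apply: is_subgroupI => [|_ _ [x [Hx <-]] [y [Hy <-]]|_ [x [Hx <-]]].
  - by exists 1; split; [apply: sg1 | rewrite (quo1 fM)].
  - by exists (x * y); split; [apply: sgM | rewrite fM].
  - by exists x^-1; split; [apply: sgV | rewrite (quoV fM)].
have [y <-] := fS g; exists (x ^ y); split; [exact: nsgJ | exact: (quoJ fM)].
Qed.

Lemma image_has_index H n : is_normal H -> (forall y, A y -> H y) ->
  has_index H n -> has_index (image_of H) n.
Proof.
move=> nH sAH /(has_indexP _ (nsg nH))[c [rho [cK cP]]].
apply/has_indexP; first exact: nsg (image_normal nH).
have [r rP] := choice fS.
have HP x : image_of H (f x) <-> H x := image_ofP x (nsg nH) sAH.
exists (fun z => c (r z)), (fun i => f (rho i)); split=> [i|x y].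
  rewrite -[RHS]cK; apply/cP; rewrite -HP fM (quoV fM) rP mulVg -(quo1 fM) HP.
  exact: sg1 (nsg nH).
by rewrite cP -HP fM (quoV fM) !rP.
Qed.

Lemma gen_image (S : gcar F -> Prop) (S' : gcar G -> Prop) :
  (forall x, S x -> gen S' (f x)) -> forall x, gen S x -> gen S' (f x).
Proof.
move=> SS'; have sS' := gen_sg S'.
apply: (gen_le (K := fun x => gen S' (f x))) => //.
apply: is_subgroupI => [|x y Sx Sy|x Sx].
- by rewrite (quo1 fM); exact: sg1.
- by rewrite fM; exact: (sgM sS').
- by rewrite (quoV fM); exact: (sgV sS').
Qed.

Lemma gen_preimage (S : gcar F -> Prop) (S' : gcar G -> Prop) :
  (forall z, S' z -> exists x, gen S x /\ f x = z) ->
  forall z, gen S' z -> exists x, gen S x /\ f x = z.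
Proof.
move=> SS'; have sS := gen_sg S.
apply: (gen_le (K := fun z => exists x, gen S x /\ f x = z)) => //.
apply: is_subgroupI => [|_ _ [x [Sx <-]] [y [Sy <-]]|_ [x [Sx <-]]].
- by exists 1; split; [exact: sg1 | rewrite (quo1 fM)].
- by exists (x * y); split; [exact: (sgM sS) | rewrite fM].
- by exists x^-1; split; [exact: (sgV sS) | rewrite (quoV fM)].
Qed.

Lemma frattini_image H x : Phi H x -> Phi (image_of H) (f x).
Proof.
have sI := frattini_sg p (image_of H).
apply: (frattini_le (K := fun x => Phi (image_of H) (f x))) => [|y z Hy Hz|y Hy].
- apply: is_subgroupI => [|y z Py Pz|y Py].
  + by rewrite (quo1 fM); exact: sg1.
  + by rewrite fM; exact: (sgM sI).
  + by rewrite (quoV fM); exact: (sgV sI).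
- by rewrite (quoR fM); apply: frattini_comm; [exists y | exists z].
- by rewrite (quoX fM); apply: frattini_pow; exists y.
Qed.

Lemma frattini_preimage K z : Phi K z -> exists x, Phi (fun x => K (f x)) x /\ f x = z.
Proof.
have sI := frattini_sg p (fun x => K (f x)).
apply: (frattini_le (K := fun z => exists x, Phi (fun x => K (f x)) x /\ f x = z)).
- apply: is_subgroupI => [|_ _ [x [Sx <-]] [y [Sy <-]]|_ [x [Sx <-]]].
  + by exists 1; split; [exact: sg1 | rewrite (quo1 fM)].
  + by exists (x * y); split; [exact: (sgM sI) | rewrite fM].
  + by exists x^-1; split; [exact: (sgV sI) | rewrite (quoV fM)].
- move=> u v Ku Kv; have [[x xu] [y yv]] := (fS u, fS v); rewrite -xu -yv.
  exists [~ x, y]; split; last exact: (quoR fM).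
  by apply: frattini_comm; rewrite ?xu ?yv.
- move=> u Ku; have [x xu] := fS u; rewrite -xu.
  exists (x ^+ p); split; last exact: (quoX fM).
  by apply: frattini_pow; rewrite xu.
Qed.

Lemma gens_preimage K l : gens_mod p K l ->
  exists l', size l' = size l /\ gens_rel p (fun x => K (f x)) A l'.
Proof.
move=> /gens_rel0 [lK Kl]; have [r rP] := choice fS.
exists (map r l); rewrite size_map; split=> //; split=> [_ /mapP[z lz ->]|h Kh].
  by rewrite rP; apply: lK.
set S := fun x => _; have sS := gen_sg S.
have [z [lz|Pz|//]|y [Sy fy]] := gen_preimage (S := S) _ (Kl _ Kh).
- by exists (r z); split=> //; apply: gen_in; apply: Or31; apply: map_f.
- by have [x [Px <-]] := frattini_preimage Pz; exists x; split=> //; apply: gen_in; apply: Or32.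
rewrite -(mulKVg y h); apply: (sgM sS Sy); apply: gen_in; apply: Or33; apply/fK.
by rewrite fM (quoV fM) fy mulVg.
Qed.

Lemma gens_image H l : gens_rel p H A l -> gens_mod p (image_of H) (map f l).
Proof.
case=> lH Hl; apply/gens_rel0; split=> [_ /mapP[x lx ->]|_ [x [Hx <-]]].
  by exists x; split=> //; apply: lH.
apply: gen_image (Hl x Hx) => y [ly|Py|/fK ->].
- by apply: gen_in; apply: Or31; apply: map_f.
- by apply: gen_in; apply: Or32; apply: frattini_image.
- exact: sg1 (gen_sg _).
Qed.

Lemma rank_lower_bound_quotient d : rank_lower_bound p G d <->
  (forall H a l, is_normal H -> has_index H (p ^ a)%N -> (forall x, A x -> H x) ->
     gens_rel p H A l -> (d * INR (p ^ a)%N + 1 <= INR (size l))%Re).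
Proof.
split=> [dG H a l nH indH sAH gH|dF K a l nK indK gK].
  rewrite -(size_map f); apply: (dG (image_of H)); last exact: gens_image.
  - exact: image_normal.
  - exact: image_has_index.
have [l' [<- gl']] := gens_preimage gK.
apply: (dF _ _ _ (preim_normal nK) (preim_has_index nK indK) _ gl') => x /fK ->.
exact: sg1 (nsg nK).
Qed.

End Transfer.

(** * Maximal sets of relators *)

Section RelativeBounds.
Variables (F : group) (p : nat).
Hypotheses (p_pr : prime p) (fgF : finitely_generated F).
Local Notation T := (gcar F).
Implicit Types H M A : T -> Prop.
Local Notation Phi := (frattini_p p).

(** The bound for the quotient of [F] by the normal closure of [M], stated in [F]. Allowing any set
    [M], with [conjs], makes adding one relator a plain union. *)
Definition rel_bound (d : R) M : Prop :=
  forall H a l, is_normal H -> has_index H (p ^ a)%N -> (forall x, M x -> H x) ->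
    gens_rel p H (conjs M) l -> (d * INR (p ^ a)%N + 1 <= INR (size l))%Re.

Lemma rel_bound_ext d M M' : (forall x, M x <-> M' x) -> rel_bound d M -> rel_bound d M'.
Proof.
by move=> MM'; suff -> : M = M' by []; apply/funext => x; apply/propext.
Qed.

Lemma conjs_sub M x : M x -> conjs M x.
Proof. by move=> Mx; exists x, 1; rewrite conjg1. Qed.

(** [power_conj_cost] replaces the conjugates of the new relator by at most p^a / p^k generators,
    which the gap between [d] and [d'] absorbs. *)
Lemma rel_bound_power d d' M g k : (d + / INR (p ^ k)%N <= d')%Re ->
  rel_bound d' M -> rel_bound d (fun x => M x \/ x = g ^+ (p ^ k)).
Proof.
move=> dd' bM H a l nH indH sMH gH.
have [|cl [scl clH clP]] := power_conj_cost p_pr nH indH (g := g) (k := k).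
  by apply: sMH; right.
have := bM H a (l ++ cl) nH indH (fun x Mx => sMH x (or_introl Mx)).
have gcl : gens_rel p H (conjs M) (l ++ cl).
  apply: (gens_rel_cat (M := fun x => exists t, x = (g ^+ (p ^ k)) ^ t)) => //.
    by move=> _ [t ->].
  apply: gens_rel_mono gH => _ [y [t [[My|->] ->]]]; apply: gen_in; right.
    by left; exists y, t.
  by right; exists t.
move=> /(_ gcl); rewrite size_cat INR_addn.
have INRp n : (0 < INR (p ^ n)%N)%Re by apply/lt_0_INR/ltP; rewrite expn_gt0 prime_gt0.
have := Rinv_0_lt_compat _ (INRp k); have := Rinv_r (INR (p ^ k)%N).
move/leP/le_INR: scl; rewrite INR_muln; have := INRp k; have := INRp a; move: dd'.
set A := INR (p ^ a)%N; set K := INR (p ^ k)%N; set e := Rinv K; set C := INR (size cl).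
move=> dd' A_gt0 K_gt0 CK Ke e_gt0 le.
have {}Ke : (K * e = 1)%Re by apply: Ke; lra.
have : (C <= A * e)%Re.
  have -> : (C = C * K * e)%Re by rewrite Rmult_assoc Ke; lra.
  by apply: Rmult_le_compat_r; lra.
have := Rmult_le_compat_r A _ _ (Rlt_le _ _ A_gt0) dd'.
lra.
Qed.

(** The closure, in the pro-p topology, of the normal closure of [M]; the quotient by it is
    residually-p. *)
Definition pclosure M : T -> Prop :=
  fun x => forall H, pnormal p H -> (forall y, M y -> H y) -> H x.

Lemma pclosure_sub M x : M x -> pclosure M x.
Proof. by move=> Mx H _; apply. Qed.

Lemma pclosure_normal M : is_normal (pclosure M).
Proof.
apply: is_normalI => [|h g Ch H pH MH]; last by apply: nsgJ (proj1 pH) (Ch H pH MH).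
apply: is_subgroupI => [H pH _|x y Cx Cy H pH MH|x Cx H pH MH]; have sH := nsg (proj1 pH).
- exact: sg1.
- by apply: sgM => //; [apply: Cx | apply: Cy].
- by apply: sgV => //; apply: Cx.
Qed.

(** Phi(H) and the conjugates of [M] generate a normal subgroup of p-power index, as it contains
    Phi(H). It therefore contains [pclosure M]. *)
Lemma rel_bound_pclosure d M : rel_bound d M -> rel_bound d (pclosure M).
Proof.
move=> bM H a l nH indH sCH gH.
apply: (bM H a) => // [x Mx|]; first by apply: sCH; apply: pclosure_sub.
apply: gens_rel_mono gH => _ [y [t [Cy ->]]].
set S := fun x => _; have nPhi := frattini_normal p nH.
have nS : is_normal (gen S).
  apply: gen_normal => x g [Px|[z [u [Mz ->]]]]; apply: gen_in.
    by left; apply: (nsgJ g nPhi).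
  by right; exists z, (u * g); rewrite conjgM.
apply: (nsgJ t nS); apply: (Cy (gen S)) => [|z Mz]; last first.
  by apply: gen_in; right; apply: conjs_sub.
have pPhi : pnormal p (Phi H).
  by apply: frattini_pnormal => //; split=> //; exists a; rewrite NatpowE.
by apply: (sub_pnormal p_pr pPhi nS) => x Px; apply: gen_in; left.
Qed.

(** [H] is finitely generated and each generator involves finitely many relators, so a single member
    of the chain suffices for all of [H]. *)
Lemma rel_bound_chain d M (C : (T -> Prop) -> Prop) : rel_bound d M ->
  (forall X, C X -> rel_bound d (fun x => M x \/ X x)) ->
  (forall X Y, C X -> C Y -> (forall x, X x -> Y x) \/ (forall x, Y x -> X x)) ->
  rel_bound d (fun x => M x \/ exists2 X, C X & X x).
Proof.
move=> bM bC totC H a l nH indH sMH gH.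
(* The empty set is adjoined to serve elements that use no relator of the chain, and the case of an
   empty chain. *)
pose C' X := C X \/ X = (fun=> False).
have bC' X : C' X -> rel_bound d (fun x => M x \/ X x).
  by case=> [/bC //|->]; apply: rel_bound_ext bM => x; split=> [|[]] //; left.
have totC' X Y : C' X -> C' Y -> (forall x, X x -> Y x) \/ (forall x, Y x -> X x).
  by case=> [CX|->]; [case=> [CY|->]; [exact: totC|right] | left].
pose S X x := [\/ x \in l, Phi H x | conjs (fun x => M x \/ X x) x].
have S_mono (X Y : T -> Prop) : (forall x, X x -> Y x) -> forall x, gen (S X) x -> gen (S Y) x.
  move=> XY; apply: gen_mono => x [lx|Px|[y [t [My ->]]]].
  - exact: Or31.
  - exact: Or32.
  - by apply: Or33; exists y, t; split=> //; case: My => [|/XY]; [left|right].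
pose K x := exists2 X, C' X & gen (S X) x.
have HK x : H x -> K x.
  move=> Hx; apply: (gen_le (K := K) _ _ (proj2 gH x Hx)) => [|y].
    apply: is_subgroupI => [|y z [X CX Xy] [Y CY Yz]|y [X CX Xy]].
    - by exists (fun=> False); [right | exact: sg1 (gen_sg _)].
    - case: (totC' X Y CX CY) => [/S_mono XY|/S_mono YX].
        by exists Y => //; apply: (sgM (gen_sg (S Y)) _ Yz); apply: XY.
      by exists X => //; apply: (sgM (gen_sg (S X)) Xy); apply: YX.
    - by exists X => //; apply: (sgV (gen_sg (S X))).
  case=> [ly|Py|[z [t [Mz ->]]]].
  - by exists (fun=> False); [right | apply: gen_in; apply: Or31].
  - by exists (fun=> False); [right | apply: gen_in; apply: Or32].
  - case: Mz => [Mz|[X CX Xz]].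
      by exists (fun=> False); [right | apply: gen_in; apply: Or33; exists z, t; split=> //; left].
    by exists X; [left | apply: gen_in; apply: Or33; exists z, t; split=> //; right].
have [s [sH Hs]] := fg_index fgF (nsg nH) indH.
have [X CX sX] : exists2 X, C' X & forall x, x \in s -> gen (S X) x.
  elim: s {Hs} sH => [_|x s IH sH]; first by exists (fun=> False) => //; right.
  have [y sy|X CX Xs] := IH; first by apply: sH; rewrite inE sy orbT.
  have [Y CY Yx] : K x by apply/HK/sH; rewrite inE eqxx.
  case: (totC' X Y CX CY) => [/S_mono XY|/S_mono YX].
    by exists Y => // y; rewrite inE => /predU1P[->|/Xs /XY].
  by exists X => // y; rewrite inE => /predU1P[->|/Xs]; first exact: YX.
apply: (bC' X CX H a) => // [x [Mx|Xx]|].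
- by apply: sMH; left.
- apply: sMH; case: CX Xx => [CX Xx|->] //; right; by exists X.
split; first by case: gH.
by move=> h /Hs; apply: gen_le => //; exact: gen_sg.
Qed.

(** The i-th relator costs at most p^(a-i-1) generators, so all together cost at most p^a = [F : H].
    This turns the free bound r - 1 into r - 2. *)
Lemma power_relators_bound r (e : nat -> T) :
  (forall H n l, is_subgroup H -> has_index H n -> gens_mod p H l ->
     (r * n + 1 <= size l + n)%N) ->
  rel_bound (INR r - 2) (fun x => exists i, x = e i ^+ (p ^ i.+1)).
Proof.
move=> bF H a l nH indH sMH gH.
have /choice[cl clP] i := power_conj_cost p_pr nH indH (sMH _ (ex_intro _ i erefl)).
pose L := flatten [seq cl i | i <- iota 0 a].
have sL : (size L <= p ^ a)%N.
  (* The term p^(a-m) is the room left for the relators from index m on. *)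
  suff /(_ a (leqnn a)) : forall m, (m <= a)%N ->
      (size (flatten [seq cl i | i <- iota 0 m]) + p ^ (a - m) <= p ^ a)%N.
    exact: leq_trans (leq_addr _ _).
  elim=> [|m IH] le_ma; first by rewrite subn0.
  have {IH} := IH (ltnW le_ma).
  rewrite -addn1 iotaD map_cat flatten_cat size_cat /= cats0 add0n addn1.
  have [scl _ _] := clP m.
  have e_am : (a - m = (a - m.+1).+1)%N by lia.
  have : (size (cl m) <= p ^ (a - m.+1))%N.
    rewrite -(leq_pmul2r (m := p ^ m.+1)) ?expn_gt0 ?prime_gt0 //.
    by rewrite -expnD subnK.
  rewrite e_am expnS; have := prime_gt1 p_pr; nia.
have gL : gens_mod p H (l ++ L).
  apply/gens_rel0; apply: (gens_rel_cat (M := conjs (fun x => exists i, x = e i ^+ (p ^ i.+1)))).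
  - by move=> x /flatten_mapP[i _ clx]; have [_ + _] := clP i; apply.
  - move=> _ [_ [t [[i ->] ->]]]; have [scl _ cli] := clP i.
    apply: gen_mono (cli t) => x [clx|]; [left | by right].
    apply/flatten_mapP; exists i => //; rewrite mem_iota /= add0n.
    (* For i >= a the exponent p^(i+1) exceeds p^a, so [cl i] is empty. *)
    case: leqP => // le_ai; move: scl clx.
    case: (cl i) => // z s /= scl; move: scl; rewrite leqNgt mulSn => /negP[].
    by apply: leq_trans (leq_addr _ _); rewrite ltn_exp2l ?prime_gt1.
  - by apply: gens_rel_mono gH => x Mx; apply: gen_in; right; right.
have := bF H _ _ (nsg nH) indH gL; rewrite size_cat => /leP/le_INR.
rewrite !INR_addn INR_muln; move/leP/le_INR: sL => /=; lra.
Qed.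

End RelativeBounds.

(** * Construction of the group *)

Lemma Zprime_prime p : Znumtheory.prime (Z.of_nat p) -> prime p.
Proof.
move=> p_pr; have [p_gt1 _] := p_pr.
apply/primeP; split=> [|d /dvdnP[e pE]]; first by lia.
have /(prime_divisors _ p_pr) : Z.divide (Z.of_nat d) (Z.of_nat p).
  by exists (Z.of_nat e); rewrite pE -multE Nat2Z.inj_mul.
by case=> [|[|[|]]] dE; apply/orP; [lia|left|right|lia]; apply/eqP; lia.
Qed.

Lemma exists_pow_inv p (eps : R) : prime p -> (0 < eps)%Re ->
  exists k, (/ INR (p ^ k)%N <= eps)%Re.
Proof.
move=> p_pr eps_gt0; have [k k_gt] := INR_unbounded (/ eps); exists k.
have e_gt0 := Rinv_0_lt_compat _ eps_gt0.
rewrite -[eps]Rinv_inv; apply: Rinv_le_contravar => //.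
apply: Rle_trans (Rlt_le _ _ k_gt) _; apply/le_INR/leP/ltnW/ltn_expl.
exact: prime_gt1.
Qed.

(** For F/A, closedness will give residually-p, the powers in [A] torsion, and the last two clauses
    the exact value of the p-gradient. *)
Lemma maximal_relators p (alpha : R) : prime p -> exists (F : group) (A : gcar F -> Prop),
  [/\ finitely_generated F, forall x, pclosure p A x -> A x,
      forall g, exists k, A (g ^+ (p ^ k)),
      rel_bound p alpha A &
      forall g, ~ A g -> ~ rel_bound p alpha (fun x => A x \/ x = g)].
Proof.
move=> p_pr; have [r r_gt] := INR_unbounded (alpha + 2).
have [F [x [genF univF]]] := free_group r.
have fgF : finitely_generated F.
  exists [seq x i | i <- enum 'I_r] => g; apply: gen_mono (genF g) => _ [i ->].
  by apply/InE/map_f; rewrite mem_enum.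
have [e eS] := fg_countable fgF.
pose M y := exists i, y = e i ^+ (p ^ i.+1).
have bM : rel_bound p alpha M.
  have := power_relators_bound (e := e) p_pr _ => /(_ r) bM.
  have {}bM : rel_bound p (INR r - 2) M.
    apply: bM => H n l sH /(has_indexP _ sH)[c [rho [cK cP]]] gH.
    exact: (free_rank_bound genF univF sH cK cP p_pr gH).
  move=> H a l nH indH sMH gH; have := bM H a l nH indH sMH gH.
  have INRp : (0 < INR (p ^ a)%N)%Re.
    by apply/lt_0_INR/ltP; rewrite expn_gt0 prime_gt0.
  have := Rmult_le_compat_r _ alpha (INR r - 2) (Rlt_le _ _ INRp); lra.
(* With [M] built into [P], the union of the empty chain also satisfies [P]. *)
pose P X := rel_bound p alpha (fun y => M y \/ X y).
have [C CP totC|A [PA maxA]] := @classical_sets.Zorn_bigcup _ P.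
  by apply: (rel_bound_chain fgF bM) => // X Y CX CY; apply: totC.
have PC : P (pclosure p (fun y => M y \/ A y)).
  apply: rel_bound_ext (rel_bound_pclosure p_pr fgF PA) => y; split=> [|[My|]] //.
    by right.
  by apply: pclosure_sub; left.
have topA (B : gcar F -> Prop) : (forall y, A y -> B y) -> P B -> forall y, B y -> A y.
  by move=> AB PB; apply: contrapT => nBA; exact: (maxA B (conj AB nBA) PB).
have CA : forall y, pclosure p (fun y => M y \/ A y) y -> A y.
  by apply: topA => // y Ay; apply: pclosure_sub; right.
have MA y : M y -> A y by move=> My; apply: CA; apply: pclosure_sub; left.
have bMA (B : gcar F -> Prop) : (forall y, A y -> B y) -> P B <-> rel_bound p alpha B.
  move=> AB; split; apply: rel_bound_ext => y; last by split=> [|[/MA/AB|]] //; right.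
  by split=> [[/MA/AB|]|] //; right.
exists F, A; split=> // [y Cy|g||g nAg bAg].
- by apply: CA => H pH sH; apply: Cy => // z Az; apply: sH; right.
- by have [i <-] := eS g; exists i.+1; apply: MA; exists i.
- exact/bMA.
- by apply: nAg; apply: (topA (fun y => A y \/ y = g)); [left | apply/bMA => //; left | right].
Qed.


Import Znumtheory.
Open Scope R_scope.

Theorem theorem3p7 (p : nat) (hp : prime (Z.of_nat p)) (alpha : R) (halpha : 0 < alpha) :
  exists G : group,
    finitely_generated G /\ residually_p G p /\ torsion G /\ p_gradient_is G p alpha.
Proof.
have p_pr := Zprime_prime hp.
have [F [A [[s sF] CA torA bA maxA]]] := maximal_relators alpha p_pr.
have clA : A = pclosure p A.
  by apply/funext => x; apply/propext; split; [apply: pclosure_sub | apply: CA].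
have nA : is_normal A by rewrite clA; apply: pclosure_normal.
have [G [f [fM fS fK]]] := quotient_group nA.
have fgG : finitely_generated G.
  exists (map f s) => z; have [x <-] := fS z.
  apply: (gen_image fM _ (sF x)) => y sy; apply: gen_in.
  by apply/InE/map_f/InE.
have conjsA x : conjs A x -> A x by case=> y [t [Ay ->]]; apply: nsgJ.
(* As [A] is normal, [A] and [conjs A] are interchangeable as relators. *)
have boundE d : rank_lower_bound p G d <-> rel_bound p d A.
  rewrite (rank_lower_bound_quotient p fM fS fK).
  split=> b H a l nH indH sAH gH; apply: (b H a l nH indH sAH);
    apply: gens_rel_mono gH => x Ax; apply: gen_in; right; first exact: conjsA.
  exact: conjs_sub.
exists G; split; first exact: fgG.
split.
  move=> z; have [x <-] := fS z => resid; apply/fK; rewrite clA => H pH sAH.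
  apply/(image_ofP fM fK _ (nsg (proj1 pH)) sAH); apply: resid.
  have [nH [k indH]] := pH; split; first exact: image_normal.
  by exists k; apply: image_has_index.
split.
  move=> z; have [x <-] := fS z; have [k Ak] := torA x.
  exists (p ^ k)%N; split; first by apply/ltP; rewrite expn_gt0 prime_gt0.
  by rewrite gpowE -(quoX fM); apply/fK.
have INRp k : 0 < INR (p ^ k)%N.
  by apply/lt_0_INR/ltP; rewrite expn_gt0 prime_gt0.
split.
  move=> _ [H [k [n [nH [indH [[[l [<- gl]] _] ->]]]]]].
  move: indH; rewrite NatpowE => indH.
  have := (boundE alpha).2 bA H k l nH indH gl.
  have := INRp k; set P := INR (p ^ k)%N; set N := INR _ => P_gt0 le.
  apply: (Rmult_le_reg_r P) => //.
  by rewrite /Rdiv Rmult_assoc Rinv_l; lra.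
move=> b b_lb; apply: Rnot_lt_le => lt_ab.
have bG : rank_lower_bound p G b.
  move=> H a l nH indH gH.
  (* The least length of a generating list is the value of d_p(H) to which [b_lb] applies. *)
  pose P n := `[< exists l, length l = n /\ gens_mod p H l >].
  have exP : exists n, P n by exists (size l); apply/asboolP; exists l.
  have [n /asboolP[l' [sl' gl']] min_n] := ex_minnP exP.
  have : b <= (INR n - 1) / INR (p ^ a)%N.
    apply: b_lb; exists H, a, n; rewrite NatpowE; split=> //; split=> //; split=> //.
    split=> [|l1 gl1]; first by exists l'.
    by apply/leP/min_n/asboolP; exists l1.
  have : INR n <= INR (size l) by apply/le_INR/leP/min_n/asboolP; exists l.
  have := INRp a; set P' := INR (p ^ a)%N => P_gt0 le_n.
  move=> /(Rmult_le_compat_r P' _ _ (Rlt_le _ _ P_gt0)).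
  by rewrite /Rdiv Rmult_assoc Rinv_l; lra.
(* With p^-k <= b - alpha, adding any x^(p^k) to [A] keeps the bound alpha. Maximality puts it in
   [A], so [G] has exponent dividing p^k. *)
have [k k_small] := exists_pow_inv p_pr (Rlt_Rminus _ _ lt_ab).
have b_gt0 : 0 < b by lra.
apply: (unbounded_exponent p_pr fgG (k := k) b_gt0 bG) => z; have [x <-] := fS z.
rewrite -(quoX fM); apply/fK; apply: contrapT => /maxA; apply.
apply: rel_bound_power ((boundE b).1 bG) => //; lra.
Qed.
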